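(* Let $\mathcal H$ be a separable complex Hilbert space and let $\Phi:\mathbb C^n\to\mathbf B(\mathcal H)$ be a Borel function such that $\mathsf T_\Phi\in\mathbf B(\mathcal B\otimes\mathcal H)$ (i.e. $\mathsf T_\Phi$ is everywhere defined and bounded) and $\mathsf T_\Phi$ is compact. Then $$\lim_{|z|\to\infty}\int_{\mathbb C^n}\big\|\big(\mathsf P(\Phi_z\otimes g)\big)(w)\big\|^2\,\mathrm d\mu_{\mathbf G}(w)=0,\qquad g\in\mathcal H,$$ where $(\Phi_z\otimes g)(u)=\Phi(u+z)g$ for $u\in\mathbb C^n$.
   Context: $n\in\mathbb N$; $|\cdot|$ is the Euclidean norm on $\mathbb C^n$. $\mu_{\mathbf G}$ is the Gaussian measure $\mathrm d\mu_{\mathbf G}(z)=\pi^{-n}e^{-|z|^2}\,\mathrm dV(z)$ on the Borel sets of $\mathbb C^n$, with $V$ Lebesgue measure. $\mathbf B(\cdot)$ denotes the algebra of bounded operators on a Hilbert space. $\mathcal B$ is the Segal-Bargmann space of entire functions in $L^2(\mu_{\mathbf G})$. $L^2(\mu_{\mathbf G})\otimes\mathcal H$ is identified with the space of $\mathcal H$-valued functions square-integrable with respect to $\mu_{\mathbf G}$, and $\mathcal B\otimes\mathcal H$ with its closed subspace of analytic functions $F:\mathbb C^n\to\mathcal H$ with $\int\|F\|^2\,\mathrm d\mu_{\mathbf G}<\infty$. $\mathsf P$ is the orthogonal projection from $L^2(\mu_{\mathbf G})\otimes\mathcal H$ onto $\mathcal B\otimes\mathcal H$. For a Borel function $\Phi:\mathbb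 C^n\to\mathbf B(\mathcal H)$ the vectorial Toeplitz operator $\mathsf T_\Phi$ has domain $\{F\in\mathcal B\otimes\mathcal H:\Phi F\in L^2(\mu_{\mathbf G})\otimes\mathcal H\}$ and acts by $\mathsf T_\Phi F=\mathsf P(\Phi F)$, where $(\Phi F)(z)=\Phi(z)F(z)$. *)

(* Defs.v *)
From HB Require Import structures.
From mathcomp Require Import all_boot all_order all_algebra.
From mathcomp Require Import complex.
From mathcomp Require Import all_classical all_reals all_analysis.
From mathcomp Require Import measurable_realfun ring lra.

Set Implicit Arguments.
Unset Strict Implicit.
Unset Printing Implicit Defensive.

Import Order.TTheory GRing.Theory Num.Theory numFieldNormedType.Exports.
Local Open Scope classical_set_scope.
Local Open Scope ring_scope.

HB.instance Definition _ (R : realType) := NormedModule.copy R[i] R[i]^o.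

(* In a normed module over R[i] the norm is R[i]-valued, with zero imaginary
   part; [rnorm] is the same number seen in R. *)
Definition rnorm (R : realType) (V : normedModType R[i]) (v : V) : R :=
  complex.Re `|v|.

HB.mixin Record CompleteNormedModule_isHilbert (R : realType) H
    of CompleteNormedModule R[i] H := {
  hdot : H -> H -> R[i] ;
  hdotPl : forall (a : R[i]) (x y z : H),
    hdot (a *: x + y) z = a * hdot x z + hdot y z ;
  hdotC : forall x y : H, hdot x y = conjc (hdot y x) ;
  hdotxx : forall x : H, hdot x x = `|x| ^+ 2
}.

#[short(type="hilbertType")]
HB.structure Definition Hilbert (R : realType) :=
  {H of CompleteNormedModule R[i] H & CompleteNormedModule_isHilbert R H}.

Definition separable (T : topologicalType) :=
  exists2 D : set T, countable D & dense D.

(* The algebra B(H), with its operator-norm topology. *)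
Section bounded_operators.
Variables (R : realType) (H : hilbertType R).

Record bop := Bop {
  bop_fun :> {linear H -> H} ;
  bop_bounded : exists M : R, forall x : H, rnorm (bop_fun x) <= M * rnorm x
}.

HB.instance Definition _ := gen_eqMixin bop.
HB.instance Definition _ := gen_choiceMixin bop.

Definition opnorm (T : H -> H) : R :=
  sup [set rnorm (T x) | x in [set x : H | rnorm x <= 1]].

Definition bop_open : set_system bop := [set U | forall T : bop, U T ->
  exists2 e : R, 0 < e &
    forall S : bop, opnorm (fun x => S x - T x) < e -> U S].

Let bop_openT : bop_open setT.
Proof. by move=> T _; exists 1. Qed.

Let bop_openI : setI_closed bop_open.
Proof.
move=> U V oU oV T [/oU[e e0 eU] /oV[f f0 fV]].
exists (Num.min e f); first by rewrite lt_min e0.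
by move=> S; rewrite lt_min => /andP[/eU US /fV VS].
Qed.

Let bop_open_bigU (I : Type) (f : I -> set bop) :
  (forall i, bop_open (f i)) -> bop_open (\bigcup_i f i).
Proof.
move=> of_ T [i _ /of_[e e0 ef]]; exists e => // S /ef fS.
by exists i.
Qed.

HB.instance Definition _ :=
  isOpenTopological.Build bop bop_openT bop_openI bop_open_bigU.

End bounded_operators.

(* C^n, as a normed space and with its Borel sets. *)
Definition cspace (R : realType) (n : nat) := 'rV[R[i]]_n.

HB.instance Definition _ R n := NormedModule.on (cspace R n).
HB.instance Definition _ R n := Pointed.on (cspace R n).
HB.instance Definition _ R n := Measurable.copy (cspace R n)
  (g_sigma_algebraType (@open (cspace R n))).

Section cspace_measurable.
Variables (R : realType).

Lemma measurable_cspace_open n (U : set (cspace R n)) :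
  open U -> measurable U.
Proof. by move=> oU; apply: sub_sigma_algebra. Qed.

Lemma continuous_cspace_measurable n (f : cspace R n -> R) :
  continuous f -> measurable_fun [set: cspace R n] f.
Proof.
move=> /continuousP cf.
apply: (measurability _ (RGenOpens.measurableE R)) => _ [_ [a [b ->] <-]].
by rewrite setTI; apply: measurable_cspace_open; apply: cf; exact: interval_open.
Qed.

Lemma Re_le_norm (z : R[i]) : `|complex.Re z| <= rnorm z.
Proof.
rewrite /rnorm normc_def /= -sqrtr_sqr ler_sqrt ?lerDl ?sqr_ge0 //.
by rewrite addr_ge0 ?sqr_ge0.
Qed.

Lemma Im_le_norm (z : R[i]) : `|complex.Im z| <= rnorm z.
Proof.
rewrite /rnorm normc_def /= -sqrtr_sqr ler_sqrt ?lerDr ?sqr_ge0 //.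
by rewrite addr_ge0 ?sqr_ge0.
Qed.

Lemma norm_le_ReIm (z : R[i]) :
  rnorm z <= `|complex.Re z| + `|complex.Im z|.
Proof.
rewrite /rnorm normc_def /= -[leRHS]ger0_norm ?addr_ge0 // -sqrtr_sqr.
rewrite ler_sqrt ?sqr_ge0 // sqrrD !real_normK ?num_real //.
by rewrite addrAC lerDl mulrn_wge0 ?mulr_ge0.
Qed.

Lemma lt_rnormP (z e : R[i]) : 0 < e -> (`|z| < e) = (rnorm z < complex.Re e).
Proof.
move=> e0; rewrite ltcE /rnorm normc_def /=.
by move: e0; rewrite ltcE => /andP[/eqP -> _]; rewrite eqxx.
Qed.

Lemma continuous_Re_coord n (j : 'I_n) :
  continuous (fun z : cspace R n => complex.Re (z 0 j)).
Proof.
move=> z; apply: (@continuous_comp (cspace R n) _ _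
  (fun z : cspace R n => z 0 j) (@complex.Re R)).
  exact: coord_continuous.
move=> A [e /= e0 eA]; exists (real_complex R e) => /=; first by rewrite ltcR.
move=> y /= ; rewrite lt_rnormP ?ltcR// => zy; apply: eA => /=.
by apply: le_lt_trans zy; rewrite -raddfB; exact: Re_le_norm.
Qed.

Lemma continuous_Im_coord n (j : 'I_n) :
  continuous (fun z : cspace R n => complex.Im (z 0 j)).
Proof.
move=> z; apply: (@continuous_comp (cspace R n) _ _
  (fun z : cspace R n => z 0 j) (@complex.Im R)).
  exact: coord_continuous.
move=> A [e /= e0 eA]; exists (real_complex R e) => /=; first by rewrite ltcR.
move=> y /= ; rewrite lt_rnormP ?ltcR// => zy; apply: eA => /=.
by apply: le_lt_trans zy; rewrite -raddfB; exact: Im_le_norm.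
Qed.

Lemma measurable_Re_coord n (j : 'I_n) :
  measurable_fun [set: cspace R n] (fun z => complex.Re (z 0 j)).
Proof. by apply: continuous_cspace_measurable; exact: continuous_Re_coord. Qed.

Lemma measurable_Im_coord n (j : 'I_n) :
  measurable_fun [set: cspace R n] (fun z => complex.Im (z 0 j)).
Proof. by apply: continuous_cspace_measurable; exact: continuous_Im_coord. Qed.

Definition rat_box n (q : {ffun 'I_n -> (rat * rat) * (rat * rat)}) :
    set (cspace R n) :=
  [set z | forall j,
    (ratr (q j).1.1 < complex.Re (z 0 j) < ratr (q j).1.2) /\
    (ratr (q j).2.1 < complex.Im (z 0 j) < ratr (q j).2.2)].

Lemma open_rat_box n (U : set (cspace R n)) : open U ->
  U = \bigcup_(q in [set q | rat_box q `<=` U]) rat_box q.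
Proof.
rewrite openE => oU; apply/seteqP; split=> [z Uz|z [q /= qU /qU//]].
have [P Pz PU] := oU z Uz.
have H j : exists q : (rat * rat) * (rat * rat),
    [/\ ratr q.1.1 < complex.Re (z 0 j) < ratr q.1.2,
        ratr q.2.1 < complex.Im (z 0 j) < ratr q.2.2 &
        forall w : R[i], ratr q.1.1 < complex.Re w < ratr q.1.2 ->
          ratr q.2.1 < complex.Im w < ratr q.2.2 -> P 0 j w].
  have [e /= e0 eP] := Pz 0 j.
  have d0 : 0 < complex.Re e / 2.
    by rewrite divr_gt0 //; move: e0; rewrite ltcE => /andP[].
  set d := complex.Re e / 2 in d0.
  have lo (x : R) : exists q : rat, x - d < ratr q < x.
    have /rat_in_itvoo[q] : x - d < x by rewrite ltrBlDr ltrDl.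
    by rewrite in_itv /=; exists q.
  have hi (x : R) : exists q : rat, x < ratr q < x + d.
    have /rat_in_itvoo[q] : x < x + d by rewrite ltrDl.
    by rewrite in_itv /=; exists q.
  have [a /andP[a1 a2]] := lo (complex.Re (z 0 j)).
  have [b /andP[b1 b2]] := hi (complex.Re (z 0 j)).
  have [a' /andP[a1' a2']] := lo (complex.Im (z 0 j)).
  have [b' /andP[b1' b2']] := hi (complex.Im (z 0 j)).
  exists ((a, b), (a', b')); split => /=; rewrite ?a2 ?a2' //.
  move=> w /andP[w1 w2] /andP[w1' w2']; apply: eP => /=; rewrite lt_rnormP//.
  apply: le_lt_trans (norm_le_ReIm _) _; rewrite (splitr (complex.Re e)).
  by rewrite !raddfB ltrD // -/d ltr_norml; apply/andP; split; lra.
have [q qP] := choice H; exists [ffun j => q j].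
  move=> w wq; apply: PU => i j; rewrite ord1.
  by have [_ _] := qP j; have := wq j; rewrite !ffunE => -[? ?]; apply.
by move=> j; rewrite !ffunE; have [? ? _] := qP j.
Qed.

Lemma measurable_funTcspace d (T : measurableType d) n (f : T -> cspace R n) :
  (forall j, measurable_fun setT (fun t => complex.Re (f t 0 j))) ->
  (forall j, measurable_fun setT (fun t => complex.Im (f t 0 j))) ->
  measurable_fun setT f.
Proof.
move=> mRe mIm; apply: (measurability (@open (cspace R n))) => //.
move=> _ [U oU <-]; rewrite setTI (open_rat_box oU) preimage_bigcup.
rewrite bigcup_mkcond; apply: countable_bigcupT_measurable => [|q].
  exact: countableP.
case: ifP => // _.
rewrite (_ : _ @^-1` _ = \bigcap_(j in [set: 'I_n])
  ((fun t => complex.Re (f t 0 j)) @^-1` `]ratr (q j).1.1, ratr (q j).1.2[ `&`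
   (fun t => complex.Im (f t 0 j)) @^-1` `]ratr (q j).2.1, ratr (q j).2.2[)).
  apply: fin_bigcap_measurable => // j _; rewrite -[X in measurable X]setTI.
  by rewrite setIIr; apply: measurableI; [exact: mRe|exact: mIm].
apply/seteqP; split=> [t tq j _|t tq j].
  by have [] := tq j; rewrite /= !in_itv.
by have [] := tq j I; rewrite /= !in_itv.
Qed.

End cspace_measurable.

(* Lebesgue measure on C^n: for n.+1 it is the image of dx dy dV_n(w) under
   (x, (y, w)) |-> (x + iy, w). *)
Section lebesgue_cspace.
Variable R : realType.
Local Notation lebR := (@lebesgue_measure R).

Definition ccons n (t : measurableTypeR R * (measurableTypeR R * cspace R n)) :
    cspace R n.+1 :=
  row_mx (const_mx (Complex t.1 t.2.1) : 'rV_1) t.2.2.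

Lemma measurable_ccons n : measurable_fun setT (@ccons n).
Proof.
apply: measurable_funTcspace => j; case: (@split_ordP 1 n j) => k ->.
- rewrite (_ : (fun _ => _) = fst) //.
  by apply/funext => t; rewrite /ccons (@row_mxEl _ 1 1 n) mxE.
- rewrite (_ : (fun _ => _) =
    (fun w : cspace R n => complex.Re (w 0 k)) \o snd \o snd).
    apply: measurableT_comp; last exact: measurable_snd.
    apply: measurableT_comp; last exact: measurable_snd.
    exact: measurable_Re_coord.
  by apply/funext => t; rewrite /ccons (@row_mxEr _ 1 1 n).
- rewrite (_ : (fun _ => _) = fst \o snd) //.
    by apply: measurableT_comp; [exact: measurable_fst|exact: measurable_snd].
  by apply/funext => t; rewrite /ccons (@row_mxEl _ 1 1 n) mxE.
- rewrite (_ : (fun _ => _) =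
    (fun w : cspace R n => complex.Im (w 0 k)) \o snd \o snd).
    apply: measurableT_comp; last exact: measurable_snd.
    apply: measurableT_comp; last exact: measurable_snd.
    exact: measurable_Im_coord.
  by apply/funext => t; rewrite /ccons (@row_mxEr _ 1 1 n).
Qed.

Section step.
Variables (n : nat) (mu : {measure set (cspace R n) -> \bar R}).

Definition lebesgue_step : set (cspace R n.+1) -> \bar R :=
  pushforward (lebR \x^ (lebR \x^ mu))%E (@ccons n).

Let step0 : lebesgue_step set0 = 0%E.
Proof. by rewrite /lebesgue_step /pushforward preimage_set0 measure0. Qed.

Let step_ge0 A : (0 <= lebesgue_step A)%E.
Proof. by rewrite /lebesgue_step /pushforward; exact: measure_ge0. Qed.

Let step_sigma_additive : semi_sigma_additive lebesgue_step.
Proof.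
have mf := @measurable_ccons n.
exact: measure_semi_sigma_additive.
Qed.

HB.instance Definition _ := isMeasure.Build _ _ _ lebesgue_step
  step0 step_ge0 step_sigma_additive.

End step.

Fixpoint lebesgue_cspace n : {measure set (cspace R n) -> \bar R} :=
  match n with
  | 0 => dirac (0 : cspace R 0)
  | m.+1 => lebesgue_step (lebesgue_cspace m)
  end.

End lebesgue_cspace.

Section gaussian_measure.
Variables (R : realType) (n : nat).

(* The Euclidean norm; `|z| on [cspace R n] is the maximum norm. *)
Definition cnorm (z : cspace R n) : R :=
  Num.sqrt (\sum_(j < n) rnorm (z 0 j) ^+ 2).

(* The filter of |z| -> +oo. *)
Definition cnorm_pinfty : set_system (cspace R n) :=
  filter_from setT (fun M : R => [set z | M < cnorm z]).

Definition gaussian_pdf (z : cspace R n) : R :=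
  pi ^- n * expR (- cnorm z ^+ 2).

Lemma gaussian_pdf_ge0 z : 0 <= gaussian_pdf z.
Proof. by rewrite mulr_ge0 ?expR_ge0 // invr_ge0 exprn_ge0 ?pi_ge0. Qed.

Lemma cnorm2E z : cnorm z ^+ 2 =
  \sum_(j < n) (complex.Re (z 0 j) ^+ 2 + complex.Im (z 0 j) ^+ 2).
Proof.
rewrite /cnorm sqr_sqrtr; last by apply: sumr_ge0 => j _; exact: sqr_ge0.
apply: eq_bigr => j _; rewrite /rnorm normc_def /= sqr_sqrtr //.
by rewrite addr_ge0 ?sqr_ge0.
Qed.

Lemma measurable_gaussian_pdf : measurable_fun setT gaussian_pdf.
Proof.
apply: measurable_funM => //; apply: measurableT_comp => //.
apply: measurableT_comp => //.
rewrite (_ : (fun z => _) = fun z : cspace R n => \sum_(j < n)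
  (complex.Re (z 0 j) ^+ 2 + complex.Im (z 0 j) ^+ 2)); last first.
  by apply/funext => z; exact: cnorm2E.
apply: measurable_sum => j; apply: measurable_funD; apply: measurable_funX.
  exact: measurable_Re_coord.
exact: measurable_Im_coord.
Qed.

Definition gaussian (A : set (cspace R n)) : \bar R :=
  (\int[lebesgue_cspace R n]_(z in A) (gaussian_pdf z)%:E)%E.

Let gaussian0 : gaussian set0 = 0%E.
Proof. by rewrite /gaussian integral_set0. Qed.

Let gaussian_ge0 A : (0 <= gaussian A)%E.
Proof. by apply: integral_ge0 => z _; rewrite lee_fin gaussian_pdf_ge0. Qed.

Let gaussian_sigma_additive : semi_sigma_additive gaussian.
Proof.
move=> F mF tF mUF; rewrite /gaussian; apply: cvg_toP.
  apply: ereal_nondecreasing_is_cvgn => k m km.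
  apply: lee_sum_nneg_natr => // i _ _; apply: integral_ge0 => z _.
  by rewrite lee_fin gaussian_pdf_ge0.
rewrite ge0_integral_bigcup//=.
- apply/measurable_funTS/measurableT_comp => //.
  exact: measurable_gaussian_pdf.
- by move=> z _; rewrite lee_fin gaussian_pdf_ge0.
Qed.

HB.instance Definition _ := isMeasure.Build _ _ _ gaussian
  gaussian0 gaussian_ge0 gaussian_sigma_additive.

End gaussian_measure.

Section toeplitz.
Variables (R : realType) (n : nat) (H : hilbertType R).
Local Notation muG := (@gaussian R n : {measure set (cspace R n) -> \bar R}).
Implicit Types (F G : cspace R n -> H) (Phi : cspace R n -> bop H).

Definition borel_fun (T : topologicalType) (f : cspace R n -> T) :=
  forall U : set T, open U -> measurable (f @^-1` U).

Definition sqnorm F : \bar R := (\int[muG]_z (rnorm (F z) ^+ 2)%:E)%E.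

(* L^2(mu_G) (x) H, through representatives. *)
Definition L2 : set (cspace R n -> H) :=
  [set F | borel_fun F /\ (sqnorm F < +oo)%E].

Definition l2norm F : R := Num.sqrt (fine (sqnorm F)).

Definition l2dot F G : R[i] :=
  Complex (\int[muG]_z complex.Re (hdot (F z) (G z)))
          (\int[muG]_z complex.Im (hdot (F z) (G z))).

(* B (x) H; [differentiable] is Frechet differentiability over R[i]. *)
Definition bargmann : set (cspace R n -> H) :=
  [set F | (forall z, differentiable F z) /\ L2 F].

(* The orthogonal projection onto B (x) H: for F in L2, the unique K in B (x) H
   such that F - K is orthogonal to B (x) H.  It is meaningful on L2 only. *)
Definition bargmann_proj F : cspace R n -> H :=
  xget (fun=> 0) [set K | bargmann K /\
    forall G, bargmann G -> l2dot (fun z => F z - K z) G = 0].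

Definition op_mul Phi F : cspace R n -> H := fun z => Phi z (F z).

Definition toeplitz_dom Phi : set (cspace R n -> H) :=
  [set F | bargmann F /\ L2 (op_mul Phi F)].

Definition toeplitz Phi F : cspace R n -> H := bargmann_proj (op_mul Phi F).

Definition toeplitz_bounded Phi :=
  toeplitz_dom Phi = bargmann /\
  exists C : R, forall F, bargmann F ->
    l2norm (toeplitz Phi F) <= C * l2norm F.

Definition toeplitz_compact Phi :=
  forall F_ : nat -> cspace R n -> H, (forall k, bargmann (F_ k)) ->
  (exists M : R, forall k, l2norm (F_ k) <= M) ->
  exists s : nat -> nat, {homo s : i j / (i < j)%N} /\
  exists2 G, bargmann G &
    l2norm (fun z => toeplitz Phi (F_ (s k)) z - G z) @[k --> \oo] --> 0.

End toeplitz.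

(* Main.v *)
From HB Require Import structures.
Require Import Defs.
From mathcomp Require Import all_boot all_order all_algebra complex.
From mathcomp Require Import all_classical all_reals all_analysis.
From mathcomp Require Import finmap measurable_realfun ring lra.
Import Order.TTheory GRing.Theory Num.Theory numFieldNormedType.Exports.
Local Open Scope classical_set_scope.
Local Open Scope ring_scope.
Set Implicit Arguments.
Unset Strict Implicit.
Unset Printing Implicit Defensive.

(** Write [k_z(u) = exp(<u,z> - |z|^2/2)] for the normalized reproducing kernel
    of the Segal-Bargmann space.  The Weyl operator
    [(W_z F)(u) = k_z(u) F(u - z)] is an isometry of [L2] (this is the
    translation behaviour of the Gaussian density) with inverse [W_{-z}]; it
    preserves holomorphy, so it commutes with the projection [P].  Since
    [W_z (Phi_z (x) g) = Phi (k_z (x) g)], the integral of the theorem is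
    [||T_Phi (k_z (x) g)||^2].  The vectors [k_z (x) g] have constant norm and
    become mutually orthogonal as the points move apart, hence tend weakly to
    [0], and a compact operator turns this into norm convergence.

    Two devices keep the argument elementary.

    - Projections are handled as a relation [is_proj].  If [Phi_z (x) g] has no
      projection then [bargmann_proj] is [0] by default and the integral
      vanishes; otherwise [W_z] transports its projection to one of
      [Phi (k_z (x) g)], and projections add up ([is_proj_weyl],
      [is_proj_sum]).  Being unique almost everywhere ([is_proj_uniq]), they can
      be compared in norm with [T_Phi (k_z (x) g)] ([sqnorm_shifted_le]).

    - Weak convergence is exploited through averages.  If the claim
      failed there would be points [q_i], as far apart as desired, with
      [K_i = T_Phi (k_{q_i} (x) g)] bounded below in norm and, by compactness,
      close to a single [G].  The moduli [|k_z| |k_w|] integrate to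
      [exp(-|z - w|^2/4)], so [||sum_{i<N} k_{q_i} (x) g||^2] grows
      linearly in [N] ([nsq_kernel_sum_le]); by boundedness so does
      [||sum_{i<N} K_i||^2].  But this sum is close to [N G], whose squared norm
      is quadratic in [N], so [G] is small ([nsq_limit_le]), a contradiction.

    The analytic input is the translation invariance of Lebesgue measure on C^n,
    the total mass of the Gaussian measure, and the complex differentiability of
    the exponential.  Separability of [H] makes sums of Borel maps Borel
    ([borel_fun2]). *)

(** * Integration against densities and product measures *)

(** The simple function approximation done once: a functional on nonnegative
    measurable functions that has the formal properties of an integral and
    agrees with [nu] on indicators is integration against [nu]. *)
Section functional.
Context d (T : measurableType d) (R : realType).
Local Open Scope ereal_scope.
Variables (nu : {measure set T -> \bar R}) (L : (T -> \bar R) -> \bar R).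
Hypothesis L1 : forall A, measurable A -> L (fun x => (\1_A x)%:E) = nu A.
Hypothesis LZ : forall (k : R) (f : T -> \bar R), (0 <= k)%R -> measurable_fun setT f ->
  (forall x, 0 <= f x) -> L (fun x => k%:E * f x) = k%:E * L f.
Hypothesis LD : forall f g : T -> \bar R, measurable_fun setT f -> measurable_fun setT g ->
  (forall x, 0 <= f x) -> (forall x, 0 <= g x) ->
  L (fun x => f x + g x) = L f + L g.
Hypothesis Llim : forall f : nat -> T -> \bar R,
  (forall n, measurable_fun setT (f n)) -> (forall n x, 0 <= f n x) ->
  (forall x, {homo f^~ x : n m / (n <= m)%N >-> n <= m}) ->
  L (fun x => limn (f^~ x)) = limn (fun n => L (f n)).

Let L0 : L (fun=> 0) = 0.
Proof.
transitivity (L (fun x => (\1_(set0 : set T) x)%:E)); last by rewrite L1.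
by congr L; apply/funext => x; rewrite indicE in_set0.
Qed.

Let Lsum (I : Type) (s : seq I) (f : I -> T -> \bar R) :
  (forall i, measurable_fun setT (f i)) -> (forall i x, 0 <= f i x) ->
  L (fun x => \sum_(i <- s) f i x) = \sum_(i <- s) L (f i).
Proof.
move=> mf f0; elim: s => [|i s IH].
  by rewrite big_nil -[RHS]L0; congr L; apply/funext => x; rewrite big_nil.
rewrite big_cons -IH -LD//.
- by congr L; apply/funext => x; rewrite big_cons.
- exact: emeasurable_sum.
- by move=> x; apply: sume_ge0.
Qed.

Import HBNNSimple.

Let Lnnsfun (h : {nnsfun T >-> R}) : L (fun x => (h x)%:E) = \int[nu]_x (h x)%:E.
Proof.
rewrite integralT_nnsfun sintegralE fsbig_finite//=.
rewrite (_ : (fun x => _) = fun x => \sum_(r <- fset_set (range h))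
   (r * \1_(h @^-1` [set r]) x)%:E); last first.
  by apply/funext => x; rewrite fimfunE fsbig_finite//= sumEFin.
rewrite Lsum; last 2 first.
- by move=> r; apply/measurable_EFinP/measurable_funM.
- by move=> r x; rewrite EFinM nnfun_muleindic_ge0.
apply: eq_bigr => r _; have [r0|r0] := leP 0%R r.
  rewrite (LZ r0 (f := fun x => (\1_(h @^-1` [set r]) x)%:E)) ?L1//.
  exact/measurable_EFinP.
rewrite preimage_nnfun0// measure0 mule0 -L0; congr L.
by apply/funext => x; rewrite indicE in_set0 mulr0.
Qed.

Lemma ge0_integral_functional f : measurable_fun setT f ->
  (forall x, 0 <= f x) -> \int[nu]_x f x = L f.
Proof.
move=> mf f0; pose f_ := nnsfun_approx measurableT mf.
have limf x : limn (fun n => (f_ n x)%:E) = f x.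
  by apply/cvg_lim => //; apply: cvg_nnsfun_approx => // y _; exact: f0.
have ndf x : {homo (fun n => (f_ n x)%:E) : n m / (n <= m)%N >-> n <= m}.
  by move=> m n mn; rewrite lee_fin; exact/lefP/nd_nnsfun_approx.
have -> : f = (fun x => limn (fun n => (f_ n x)%:E)).
  by apply/funext => x; rewrite limf.
rewrite monotone_convergence//; last 2 first.
- by move=> n; exact/measurable_EFinP/measurable_funP.
- by move=> n x _; rewrite lee_fin.
rewrite (Llim (f := fun n x => (f_ n x)%:E))//.
- by congr (limn _); apply/funext => n; rewrite -Lnnsfun.
- by move=> n; exact/measurable_EFinP/measurable_funP.
- by move=> n x; rewrite lee_fin.
Qed.

End functional.

Section functional_instances.
Local Open Scope ereal_scope.

Lemma ge0_integral_density d (T : measurableType d) (R : realType)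
    (nu mu : {measure set T -> \bar R}) (p : T -> R) :
  measurable_fun setT p -> (forall x, 0 <= p x)%R ->
  (forall A, measurable A -> nu A = \int[mu]_(x in A) (p x)%:E) ->
  forall f, measurable_fun setT f -> (forall x, 0 <= f x) ->
  \int[nu]_x f x = \int[mu]_x (f x * (p x)%:E).
Proof.
move=> mp p0 nuE f mf f0.
have mpE : measurable_fun setT (fun x => (p x)%:E) by exact/measurable_EFinP.
have pE0 x : 0 <= (p x)%:E by rewrite lee_fin.
apply: (ge0_integral_functional
  (L := fun f => \int[mu]_x (f x * (p x)%:E))) => //.
- move=> A mA; rewrite nuE// [RHS]integral_mkcond; apply: eq_integral => x _.
  by rewrite patchE indicE; case: ifP; rewrite ?mul1e ?mul0e.
- move=> k h k0 mh h0; rewrite -ge0_integralZl//.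
  + by apply: eq_integral => x _; rewrite muleA.
  + exact: emeasurable_funM.
  + by move=> x _; rewrite mule_ge0.
- move=> g h mg mh g0 h0; rewrite -ge0_integralD//.
  + by apply: eq_integral => x _; rewrite ge0_muleDl.
  + by move=> x _; rewrite mule_ge0.
  + exact: emeasurable_funM.
  + by move=> x _; rewrite mule_ge0.
  + exact: emeasurable_funM.
- move=> h mh h0 ndh; rewrite -monotone_convergence//.
  + apply: eq_integral => x _; rewrite muleC -limeMl//.
      by congr (limn _); apply/funext => n; rewrite muleC.
    exact: ereal_nondecreasing_is_cvgn.
  + by move=> n; exact: emeasurable_funM.
  + by move=> n x _; rewrite mule_ge0.
  + by move=> x _ m n mn; apply: lee_wpmul2r => //; exact: ndh.
Qed.

(** Only the sections in the first variable have to be measured measurably, hence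
    the asymmetry; [m2] will be [lebesgue_cspace], which carries no sigma-finite
    structure. *)
Lemma ge0_integral_product2 d1 d2 (T1 : measurableType d1)
    (T2 : measurableType d2) (R : realType)
    (m1 : {sigma_finite_measure set T1 -> \bar R})
    (m2 : {measure set T2 -> \bar R}) (f : T1 * T2 -> \bar R) :
  measurable_fun setT f -> (forall x, 0 <= f x) ->
  \int[m1 \x^ m2]_z f z = \int[m2]_y \int[m1]_x f (x, y).
Proof.
have mG (h : T1 * T2 -> \bar R) : measurable_fun setT h -> (forall x, 0 <= h x) ->
    measurable_fun setT (fun y => \int[m1]_x h (x, y)).
  exact: measurable_fun_fubini_tonelli_G.
have ms (h : T1 * T2 -> \bar R) y :
    measurable_fun setT h ->
    measurable_fun setT (fun x : T1 => h (x, y : T2) : \bar R).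
  by move=> mh; exact: (measurableT_comp mh (pair2_measurable y)).
apply: (ge0_integral_functional
  (L := fun f => \int[m2]_y \int[m1]_x f (x, y))) => //.
- move=> A mA; apply: eq_integral => y _.
  by have /funeqP/(_ y) := indic_fubini_tonelli_GE m1 mA.
- move=> k h k0 mh h0; rewrite -ge0_integralZl//.
  + apply: eq_integral => y _; rewrite -ge0_integralZl//.
    exact: ms.
  + exact: mG.
  + by move=> y _; apply: integral_ge0.
- move=> g h mg mh g0 h0; rewrite -ge0_integralD//.
  + by apply: eq_integral => y _; rewrite ge0_integralD//; exact: ms.
  + by move=> y _; apply: integral_ge0.
  + exact: mG.
  + by move=> y _; apply: integral_ge0.
  + exact: mG.
- move=> h mh h0 ndh; rewrite -monotone_convergence//.
  + apply: eq_integral => y _; rewrite -monotone_convergence//.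
      by move=> n; exact: ms.
  + by move=> n; exact: mG.
  + by move=> n y _; apply: integral_ge0.
  + move=> y _ m n mn; apply: ge0_le_integral => //.
    * exact: ms.
    * exact: ms.
    * by move=> x _; exact: ndh.
Qed.

End functional_instances.

(** * Translation invariance of Lebesgue measure *)

Section invariance.
Local Open Scope ereal_scope.

Lemma ge0_integral_invariant d (T : measurableType d) (R : realType)
    (mu : {measure set T -> \bar R}) (t : T -> T) :
  measurable_fun setT t ->
  (forall A, measurable A -> mu (t @^-1` A) = mu A) ->
  forall f : T -> \bar R, measurable_fun setT f -> (forall x, 0 <= f x) ->
  \int[mu]_x f (t x) = \int[mu]_x f x.
Proof.
move=> mt mut f mf f0.
rewrite -[LHS](ge0_integral_pushforward mt mu measurableT mf)//.
by apply: eq_measure_integral => A mA _; exact: mut.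
Qed.

(** Sections of a preimage under [t1 x t2] are preimages under [t1] of sections
    taken at a point moved by [t2]. *)
Lemma product_measure2_invariant d1 d2 (T1 : measurableType d1)
    (T2 : measurableType d2) (R : realType)
    (m1 : {sigma_finite_measure set T1 -> \bar R})
    (m2 : {measure set T2 -> \bar R}) (t1 : T1 -> T1) (t2 : T2 -> T2) :
  measurable_fun setT t1 -> measurable_fun setT t2 ->
  (forall A, measurable A -> m1 (t1 @^-1` A) = m1 A) ->
  (forall A, measurable A -> m2 (t2 @^-1` A) = m2 A) ->
  forall A, measurable A ->
  (m1 \x^ m2) ((fun x => (t1 x.1, t2 x.2)) @^-1` A) = (m1 \x^ m2) A.
Proof.
move=> mt1 mt2 m1t m2t A mA; rewrite /product_measure2.
transitivity (\int[m2]_y (m1 \o ysection A) (t2 y)).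
  apply: eq_integral => y _ /=.
  rewrite -(m1t (ysection A (t2 y))); last exact: measurable_ysection.
  by congr (m1 _); apply/seteqP; split=> x; rewrite /= /ysection /= !inE.
by apply: ge0_integral_invariant => //; exact: measurable_fun_ysection.
Qed.

End invariance.

Section lebesgue_translation.
Variable R : realType.
Local Notation lebR := (@lebesgue_measure R).

Lemma measurable_addr (a : R) :
  measurable_fun setT (fun x : measurableTypeR R => (x : R) + a : measurableTypeR R).
Proof. exact: measurable_funD. Qed.

Lemma lebesgue_measure_translation (a : R) (A : set (measurableTypeR R)) :
  measurable A ->
  lebR ((fun x : measurableTypeR R => (x : R) + a : measurableTypeR R) @^-1` A)
  = lebR A.
Proof.
move=> mA; apply/esym.
apply: (lebesgue_measure_unique (mu := pushforward lebR
  (fun x : measurableTypeR R => (x : R) + a : measurableTypeR R))) => //=.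
  exact: measurable_addr. move=> _ _ [[x y]] _ <-.
rewrite /pushforward/= (_ : _ @^-1` _ = `]x - a, y - a]%classic); last first.
  by apply/seteqP; split=> z /=; rewrite !in_itv/= ltrBlDr lerBrDr.
by rewrite !lebesgue_measure_itv/= !lte_fin ltrD2r -!EFinB opprB addrA subrK.
Qed.

Lemma measurable_translation n (z : cspace R n) :
  measurable_fun setT (fun u : cspace R n => u + z).
Proof.
apply: measurable_funTcspace => j.
- under eq_fun do rewrite mxE raddfD.
  by apply: measurable_funD => //; exact: measurable_Re_coord.
- under eq_fun do rewrite mxE raddfD.
  by apply: measurable_funD => //; exact: measurable_Im_coord.
Qed.

(** A translation of C^{n+1} is, in the coordinates of [ccons], a product of two
    real translations and a translation of C^n. *)
Lemma lebesgue_cspace_translation n (z : cspace R n) (A : set (cspace R n)) :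
  measurable A ->
  lebesgue_cspace R n ((fun u => u + z) @^-1` A) = lebesgue_cspace R n A.
Proof.
elim: n z A => [|n IH] z A mA.
  congr (lebesgue_cspace R 0 _); apply/seteqP.
  by split=> u /=; rewrite (_ : u + z = u)//; apply/rowP => -[].
pose z0 : R[i] := z 0 (lshift n (0 : 'I_1)).
pose z' : cspace R n := rsubmx (z : 'rV_(1 + n)).
rewrite /= /lebesgue_step /pushforward.
have H := product_measure2_invariant (m1 := lebR)
  (m2 := lebesgue_cspace R n) (@measurable_addr (complex.Im z0))
  (@measurable_translation n z') (@lebesgue_measure_translation _) (IH z').
have mt2 : measurable_fun setT (fun x : measurableTypeR R * cspace R n =>
    ((x.1 : R) + complex.Im z0 : measurableTypeR R, x.2 + z')).
  apply/measurable_fun_pairP; split.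
    by apply: measurableT_comp (@measurable_addr _) _.
  by apply: measurableT_comp (@measurable_translation _ _) _.
rewrite -[RHS](product_measure2_invariant (@measurable_addr (complex.Re z0)) mt2
  (@lebesgue_measure_translation _) H); last first.
  by rewrite -[X in measurable X]setTI; exact: measurable_ccons.
congr (_ _); apply/seteqP.
have E t : @ccons R n t + z = ccons (t.1 + complex.Re z0, (t.2.1 + complex.Im z0, t.2.2 + z')).
  apply/rowP => j; rewrite mxE; case: (@split_ordP 1 n j) => k -> /=.
    by rewrite /ccons !(@row_mxEl _ 1 1 n) !mxE (ord1 k) /z0; case: (z 0 _).
  by rewrite /ccons !(@row_mxEr _ 1 1 n) !mxE.
by split=> t /=; rewrite E.
Qed.

End lebesgue_translation.

(** * Gaussian measure: translations and total mass *)

Section gaussian_shift.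
Variables (R : realType) (n : nat).
Local Notation lebR := (@lebesgue_measure R).
Local Notation muG := (@gaussian R n : {measure set (cspace R n) -> \bar R}).
Implicit Types u v z : cspace R n.

Lemma ge0_integral_gaussian (f : cspace R n -> \bar R) :
  measurable_fun setT f -> (forall u, 0 <= f u)%E ->
  (\int[muG]_u f u = \int[lebesgue_cspace R n]_u (f u * (gaussian_pdf u)%:E))%E.
Proof.
apply: ge0_integral_density => //.
- exact: measurable_gaussian_pdf.
- exact: gaussian_pdf_ge0.
Qed.

(** The real inner product of C^n, whose squared norm is [cnorm z ^+ 2]. *)
Definition rdotc u z : R := \sum_(j < n)
  (complex.Re (u 0 j) * complex.Re (z 0 j) +
   complex.Im (u 0 j) * complex.Im (z 0 j)).

(** The modulus of the normalized reproducing kernel at [z]. *)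
Definition kabs z u : R := expR (rdotc u z - cnorm z ^+ 2 / 2).

Lemma cnorm2B u z :
  cnorm (u - z) ^+ 2 = cnorm u ^+ 2 - rdotc u z *+ 2 + cnorm z ^+ 2.
Proof.
rewrite !cnorm2E /rdotc -sumrMnl -sumrB -big_split /=.
by apply: eq_bigr => j _; rewrite !mxE !raddfB /=; ring.
Qed.

Lemma gaussian_pdfB u z : gaussian_pdf (u - z) = gaussian_pdf u * kabs z u ^+ 2.
Proof.
rewrite /gaussian_pdf -mulrA; congr (_ * _).
rewrite /kabs -expRM_natl -expRD cnorm2B; congr expR.
by rewrite -[_ *+ 2]mulr_natr; field.
Qed.

Lemma measurable_rdotc z : measurable_fun setT (rdotc ^~ z).
Proof.
apply: measurable_sum => j; apply: measurable_funD; apply: measurable_funM => //.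
  exact: measurable_Re_coord.
exact: measurable_Im_coord.
Qed.

Lemma measurable_kabs z : measurable_fun setT (kabs z).
Proof.
apply: measurableT_comp => //; apply: measurable_funB => //.
exact: measurable_rdotc.
Qed.

Lemma kabs_ge0 z u : 0 <= kabs z u. Proof. exact: expR_ge0. Qed.

(** Completing the square, [|k_z|^2] is exactly the ratio between the translated
    Gaussian density and the original one. *)
Lemma gaussian_translation z (f : cspace R n -> \bar R) :
  measurable_fun setT f -> (forall u, 0 <= f u)%E ->
  (\int[muG]_u (f (u - z)%R * (kabs z u ^+ 2)%:E) = \int[muG]_u f u)%E.
Proof.
move=> mf f0.
have mpdf := @measurable_gaussian_pdf R n.
rewrite !ge0_integral_gaussian//; last 2 first.
- apply: emeasurable_funM.
    exact: (measurableT_comp mf (@measurable_translation R n (- z))).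
  by apply/measurable_EFinP; apply: measurable_funX; exact: measurable_kabs.
- by move=> u; rewrite mule_ge0// lee_fin sqr_ge0.
rewrite -[RHS](ge0_integral_invariant (@measurable_translation R n (- z))
  (@lebesgue_cspace_translation R n (- z))); last 2 first.
- by apply: emeasurable_funM => //; exact/measurable_EFinP.
- by move=> u; rewrite mule_ge0// lee_fin gaussian_pdf_ge0.
apply: eq_integral => u _; rewrite -muleA -EFinM; congr (_ * _%:E)%E.
by rewrite gaussian_pdfB mulrC.
Qed.

End gaussian_shift.

Section gaussian_mass.
Variable R : realType.
Local Notation lebR := (@lebesgue_measure R).

Let expN_cnorm2 n (z : cspace R n) := expR (- cnorm z ^+ 2).

Let measurable_expN_cnorm2 n : measurable_fun setT (@expN_cnorm2 n).
Proof.
rewrite (_ : @expN_cnorm2 n = (fun z => pi ^+ n * gaussian_pdf z)).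
  by apply: measurable_funM => //; exact: measurable_gaussian_pdf.
apply/funext => z; rewrite mulrA divff ?mul1r//.
by rewrite expf_neq0// gt_eqF// pi_gt0.
Qed.

Let integral_expN_cnorm2 n :
  (\int[lebesgue_cspace R n]_z (expN_cnorm2 z)%:E = (pi ^+ n)%:E)%E.
Proof.
have e0 m (z : cspace R m) : (0 <= (expN_cnorm2 z)%:E)%E.
  by rewrite lee_fin expR_ge0.
have mE m : measurable_fun setT (fun z : cspace R m => (expN_cnorm2 z)%:E).
  exact/measurable_EFinP.
have g0 (x : R) : (0 <= (gauss_fun x)%:E)%E by rewrite lee_fin gauss_fun_ge0.
have mg : measurable_fun setT (fun x : R => (gauss_fun x)%:E).
  by apply/measurable_EFinP; exact: measurable_gauss_fun.
elim: n => [|n IH].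
  rewrite integral_dirac//=; last exact: mE.
  by rewrite diracE in_setT mul1e /expN_cnorm2 cnorm2E big_ord0 oppr0 expR0 expr0.
rewrite /=.
transitivity (\int[(lebR \x^ (lebR \x^ lebesgue_cspace R n))%E]_t
    ((@expN_cnorm2 n.+1 \o (@ccons R n)) t)%:E)%E.
  rewrite -[RHS](ge0_integral_pushforward (@measurable_ccons R n) _ measurableT (mE n.+1))//.
have cE t : expN_cnorm2 (@ccons R n t) = gauss_fun t.1 * (gauss_fun t.2.1 * expN_cnorm2 t.2.2).
  rewrite /expN_cnorm2 /gauss_fun -!expRD; congr expR.
  rewrite !cnorm2E (@big_split_ord _ _ _ 1 n) big_ord1 /=.
  rewrite /ccons !(@row_mxEl _ 1 1 n) !mxE /= !opprD addrA; congr (_ - _).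
  by apply: eq_bigr => j _; rewrite !(@row_mxEr _ 1 1 n).
have I1 (c : R) : 0 <= c -> (\int[lebR]_x (gauss_fun x * c)%:E = (Num.sqrt pi * c)%:E)%E.
  move=> c0; under eq_integral do rewrite EFinM.
  by rewrite ge0_integralZr// integralT_gauss -EFinM.
have mc : measurable_fun setT (fun t => (expN_cnorm2 (@ccons R n t))%:E).
  exact: (measurableT_comp (mE n.+1) (@measurable_ccons R n)).
have q0 : 0 <= Num.sqrt pi :> R by exact: sqrtr_ge0.
rewrite (ge0_integral_product2 lebR (lebR \x^ lebesgue_cspace R n)%E) //=.
under eq_integral => t _.
  under eq_integral => x _ do rewrite cE/=.
  rewrite I1 ?mulr_ge0 ?gauss_fun_ge0 ?expR_ge0//.
  over.
rewrite (ge0_integral_product2 lebR (lebesgue_cspace R n)) //=; last 2 first.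
- apply/measurable_EFinP; apply: measurable_funM => //; apply: measurable_funM.
    by apply: measurableT_comp => //; exact: measurable_gauss_fun.
  exact: measurableT_comp.
- by move=> t; rewrite lee_fin !mulr_ge0 ?gauss_fun_ge0 ?expR_ge0.
under eq_integral => t _.
  under eq_integral => x _ do rewrite mulrCA.
  rewrite I1 ?mulr_ge0 ?expR_ge0//.
  rewrite mulrA -expr2 sqr_sqrtr ?pi_ge0//.
  rewrite EFinM.
  over.
rewrite ge0_integralZl// ?lee_fin ?pi_ge0//; last exact: mE.
by rewrite IH -EFinM exprS.
Qed.

(** By Tonelli the mass is a product of [2 n] one-dimensional Gaussian integrals. *)
Lemma gaussianT n : @gaussian R n setT = 1%E.
Proof.
rewrite /gaussian /gaussian_pdf; under eq_integral do rewrite EFinM.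
have mE : measurable_fun setT (fun z : cspace R n => (expN_cnorm2 z)%:E).
  exact/measurable_EFinP.
have c0 : (0 <= (pi ^- n : R)%:E)%E by rewrite lee_fin invr_ge0 exprn_ge0 ?pi_ge0.
have e0 (z : cspace R n) : setT z -> (0 <= (expN_cnorm2 z)%:E)%E.
  by rewrite lee_fin expR_ge0.
rewrite (ge0_integralZl _ measurableT mE e0 c0).
rewrite integral_expN_cnorm2 -EFinM mulVf//.
by rewrite expf_neq0// gt_eqF// pi_gt0.
Qed.

End gaussian_mass.

(** * Borel maps into separable normed spaces *)

Section rnorm_theory.
Variable R : realType.
Implicit Types V : normedModType R[i].

Lemma normE V (v : V) : `|v| = real_complex R (rnorm v).
Proof. by apply/esym/RRe_real; exact: normr_real. Qed.

Lemma rnorm_ge0 V (v : V) : 0 <= rnorm v.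
Proof. by rewrite -ler0c -normE. Qed.

Lemma rnorm0 V : rnorm (0 : V) = 0.
Proof. by rewrite /rnorm normr0. Qed.

Lemma rnormN V (v : V) : rnorm (- v) = rnorm v.
Proof. by rewrite /rnorm normrN. Qed.

Lemma rnormB V (v w : V) : rnorm (v - w) = rnorm (w - v).
Proof. by rewrite /rnorm distrC. Qed.

Lemma ler_rnormD V (v w : V) : rnorm (v + w) <= rnorm v + rnorm w.
Proof. by have := ler_normD v w; rewrite !normE -rmorphD lecR. Qed.

Lemma rnormM (a b : R[i]) : rnorm (a * b) = rnorm a * rnorm b.
Proof. by rewrite /rnorm normrM !normE -rmorphM. Qed.

Lemma rnormZ V (a : R[i]) (v : V) : rnorm (a *: v) = rnorm a * rnorm v.
Proof. by rewrite /rnorm normrZ !normE -rmorphM. Qed.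

(** Radii in R[i] are awkward; this describes neighbourhoods by balls of real
    radius. *)
Lemma nbhs_rnormP V (x : V) (A : set V) :
  nbhs x A <-> exists2 e : R, 0 < e & forall y, rnorm (x - y) < e -> A y.
Proof.
split.
  move=> /nbhs_ballP[e /= e0]; rewrite -ball_normE => eA.
  exists (complex.Re e); first by move: e0; rewrite ltcE => /andP[].
  move=> y xy; apply: eA => /=; rewrite normE.
  by move: e0; rewrite !ltcE/= => /andP[/eqP -> _]; rewrite eqxx.
move=> [e e0 eA]; apply/nbhs_ballP; exists (real_complex R e) => /=.
  by rewrite ltcR.
by rewrite -ball_normE => y /=; rewrite normE ltcR => /eA.
Qed.

Lemma continuous_rnorm V : continuous (@rnorm R V).
Proof.
move=> x; apply/cvgrPdist_lt => e e0; apply/nbhs_rnormP; exists e => // y xy.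
apply: le_lt_trans xy; rewrite ler_norml; apply/andP; split.
  rewrite lerBrDl -lerBrDr opprK rnormB.
  by have := ler_rnormD (y - x) x; rewrite subrK addrC.
by rewrite lerBlDr; apply: le_trans (ler_rnormD _ _); rewrite subrK.
Qed.

End rnorm_theory.

Section borel.
Variables (R : realType) (n : nat).
Local Notation C := (cspace R n).

Lemma borel_continuous (T : topologicalType) (f : C -> T) :
  continuous f -> borel_fun f.
Proof. by move=> /continuousP cf U /cf; exact: measurable_cspace_open. Qed.

Lemma borel_comp (S T : topologicalType) (f : C -> S) (g : S -> T) :
  borel_fun f -> continuous g -> borel_fun (g \o f).
Proof. by move=> bf /continuousP cg U /cg /bf. Qed.

Lemma borel_translation (T : topologicalType) (f : C -> T) (z : C) :
  borel_fun f -> borel_fun (fun u => f (u + z)).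
Proof.
move=> bf U /bf mU; rewrite -[X in measurable X]setTI.
exact: (@measurable_translation R n z measurableT _ mU).
Qed.

Lemma borel_measurable (f : C -> R) : borel_fun f -> measurable_fun setT f.
Proof.
move=> bf; apply: (measurability _ (RGenOpens.measurableE R)).
move=> _ [_ [a [b ->] <-]]; rewrite setTI; apply: bf; exact: interval_open.
Qed.

(** A Borel set in [S * H] need not be generated by boxes, but an open set is a
    countable union of boxes as soon as one of the two factors is second
    countable.  The boxes are [W dk x V dk], where [V dk] is a ball around a point
    of the dense set and [W dk] the largest open set making the box fit. *)
Lemma borel_fun2 (H : normedModType R[i]) (S T : topologicalType) (f : C -> S) (g : C -> H)
    (h : S * H -> T) : separable H ->
  borel_fun f -> borel_fun g -> continuous h ->
  borel_fun (fun u => h (f u, g u)).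
Proof.
move=> [D cD dD] bf bg /continuousP ch U oU.
pose V (dk : H * nat) := [set y : H | rnorm (dk.1 - y) < dk.2.+1%:R^-1].
pose W dk := [set x : S | V dk `<=` [set y | U (h (x, y))]]°.
have oV dk : open (V dk).
  have /continuousP cV : continuous (fun y : H => rnorm (dk.1 - y)).
    move=> y; apply: (continuous_comp (f := fun y => dk.1 - y)).
      by apply: continuousB; [exact: cst_continuous|].
    exact: continuous_rnorm.
  by apply: (cV [set x | x < dk.2.+1%:R^-1]); exact: open_lt.
suff -> : (fun u => h (f u, g u)) @^-1` U =
    \bigcup_(dk in D `*` [set: nat]) (f @^-1` W dk `&` g @^-1` V dk).
  rewrite bigcup_set_type; apply: countable_bigcupT_measurable => [|[dk ?]].
    rewrite (eq_countable (card_setT _)).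
    by apply: countableX => //; exact: countableP.
  apply: measurableI; [apply: bf; exact: open_interior|exact: bg].
apply/seteqP; split => [u /= Uu|u [dk _ [/= /interior_subset /= Wu Vu]]]; last exact: Wu.
have /ch := oU; rewrite openE => /(_ _ Uu) [[P Q] /= [Pu Qu] PQ].
have [e e0 eQ] := (nbhs_rnormP _ _).1 Qu.
have [k ke] : exists k, k.+1%:R^-1 < e / 2.
  have e20 : 0 < e / 2 by rewrite divr_gt0.
  have [k _ kP] := near_infty_natSinv_lt (PosNum e20).
  by exists k; apply: (kP k) => /=.
have [|d [/= dV Dd]] := dD (V (g u, k)) _ (oV _).
  by exists (g u); rewrite /V /= subrr rnorm0 invr_gt0.
exists (d, k); first by [].
split=> /=; last by rewrite /V /= rnormB.
apply: filterS Pu => x Px y /= Vy.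
apply: (PQ (x, y)); split => //=; apply: eQ.
rewrite -[g u - y](subrKA d); apply: le_lt_trans (ler_rnormD _ _) _.
by rewrite (splitr e) ltrD//; apply: lt_trans ke.
Qed.

Lemma borelD (H : normedModType R[i]) (F G : C -> H) : separable H ->
  borel_fun F -> borel_fun G -> borel_fun (fun u => F u + G u).
Proof.
move=> sH bF bG; apply: (borel_fun2 (h := fun x : H * H => x.1 + x.2)) => //.
exact: add_continuous.
Qed.

Lemma borelZ (H : normedModType R[i]) (k : C -> R[i]^o) (F : C -> H) : separable H ->
  continuous k -> borel_fun F -> borel_fun (fun u => k u *: F u).
Proof.
move=> sH ck bF.
apply: (borel_fun2 (h := fun x : R[i]^o * H => x.1 *: x.2)) => //.
  exact: borel_continuous.
exact: scale_continuous.
Qed.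

End borel.

(** * The pre-Hilbert structure of L2 *)

Section hilbert_space.
Local Open Scope complex_scope.
Variables (R : realType) (H : hilbertType R).
Implicit Types x y z : H.

Definition redot x y : R := complex.Re (hdot x y).

Lemma redotDl x y z : redot (x + y) z = redot x z + redot y z.
Proof. by rewrite /redot -[x]scale1r hdotPl mul1r raddfD scale1r. Qed.

Lemma redotC x y : redot x y = redot y x.
Proof. by rewrite /redot hdotC; case: (hdot y x). Qed.

Lemma redotDr x y z : redot x (y + z) = redot x y + redot x z.
Proof. by rewrite redotC redotDl !(redotC x). Qed.

Lemma redotxx x : redot x x = rnorm x ^+ 2.
Proof. by rewrite /redot hdotxx normE -rmorphXn. Qed.

Lemma hdot0l y : hdot 0 y = 0.
Proof.
have := hdotPl 1 0 0 y; rewrite scale1r addr0 mul1r => /eqP.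
by rewrite -subr_eq subrr => /eqP.
Qed.

Lemma redotNl x y : redot (- x) y = - redot x y.
Proof.
apply/eqP; rewrite -addr_eq0 -redotDl addrC subrr /redot.
by rewrite hdot0l.
Qed.

(** Reduces orthogonality for [hdot] to orthogonality for [redot] against a family
    stable under multiplication by ['i]. *)
Lemma Im_hdot x y : complex.Im (hdot x y) = redot x ('i *: y).
Proof.
rewrite /redot [in RHS]hdotC -['i *: y]addr0 hdotPl hdot0l addr0 hdotC.
by case: (hdot y x) => a b /=; rewrite /= !mul0r !mul1r sub0r.
Qed.

Lemma rnorm2D x y : rnorm (x + y) ^+ 2 = rnorm x ^+ 2 + redot x y *+ 2 + rnorm y ^+ 2.
Proof. by rewrite -!redotxx redotDl !redotDr (redotC y x); ring. Qed.

Lemma redotE x y :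
  redot x y = (rnorm (x + y) ^+ 2 - rnorm x ^+ 2 - rnorm y ^+ 2) / 2.
Proof. by rewrite rnorm2D -mulr_natr; field. Qed.

Lemma redot_le x y : `|redot x y| <= (rnorm x ^+ 2 + rnorm y ^+ 2) / 2.
Proof.
have h1 := rnorm2D x y; have h2 := rnorm2D (- x) y.
rewrite redotNl rnormN in h2.
have := sqr_ge0 (rnorm (x + y)); have := sqr_ge0 (rnorm (- x + y)).
rewrite h1 h2 ler_norml; clear h1 h2.
move: (rnorm x ^+ 2) (rnorm y ^+ 2) (redot x y) => a b c ? ?.
by apply/andP; split; lra.
Qed.

(** With this inequality in place of the triangle inequality, squared norms can be
    compared directly under the integral sign. *)
Lemma rnorm2D_le x y : rnorm (x + y) ^+ 2 <= rnorm x ^+ 2 *+ 2 + rnorm y ^+ 2 *+ 2.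
Proof.
have := redot_le x y; rewrite rnorm2D ler_norml => /andP[].
by move: (rnorm x ^+ 2) (rnorm y ^+ 2) (redot x y) => a b c ? ?; lra.
Qed.

Lemma rnorm2_sum_le (I : Type) (s : seq I) (f : I -> H) :
  rnorm (\sum_(i <- s) f i) ^+ 2 <= (size s)%:R * \sum_(i <- s) rnorm (f i) ^+ 2.
Proof.
suff CS : rnorm (\sum_(i <- s) f i) ^+ 2 <= (\sum_(i <- s) rnorm (f i)) ^+ 2.
  apply: le_trans CS _; elim: s => [|i s IH].
    by rewrite !big_nil expr0n mul0r.
  rewrite !big_cons /= -natr1 mulrDr !mulrDl !mul1r.
  set S := \sum_(_ <- _) _ in IH *; set Q := \sum_(_ <- _) _ in IH *.
  set a := rnorm (f i); set m : R := (size s)%:R in IH *.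
  suff : a * S *+ 2 <= m * a ^+ 2 + Q.
    move: IH; rewrite sqrrD; move: (a ^+ 2) (S ^+ 2) (a * S) (m * Q) (m * a ^+ 2) => ? ? ? ? ? ? ?; lra.
  rewrite /S /Q /m => {IH}; elim: (s) => [|j s' IH].
    by rewrite !big_nil/= mulr0 mul0rn mul0r addr0.
  rewrite !big_cons /= -natr1 !mulrDr mulrDl mul1r.
  have := sqr_ge0 (a - rnorm (f j)); rewrite sqrrB mulrnDl; lra.
rewrite ler_sqr ?nnegrE ?rnorm_ge0 ?sumr_ge0//; last by move=> *; exact: rnorm_ge0.
elim: s => [|i s IH]; first by rewrite !big_nil rnorm0.
by rewrite !big_cons; apply: le_trans (ler_rnormD _ _) _; rewrite lerD2l.
Qed.

End hilbert_space.

Section L2.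
Local Open Scope complex_scope.
Variables (R : realType) (n : nat) (H : hilbertType R).
Hypothesis sH : separable H.
Local Notation C := (cspace R n).
Local Notation muG := (@gaussian R n : {measure set C -> \bar R}).
Implicit Types F G K : C -> H.

(** Real-valued version of [sqnorm]; it carries information on [L2] only. *)
Definition nsq F : R := fine (sqnorm F).

Lemma sqnorm_ge0 F : (0 <= sqnorm F)%E.
Proof. by apply: integral_ge0 => z _; rewrite lee_fin sqr_ge0. Qed.

Lemma nsq_ge0 F : 0 <= nsq F.
Proof. exact/fine_ge0/sqnorm_ge0. Qed.

Lemma nsqE F : L2 F -> sqnorm F = (nsq F)%:E.
Proof. by move=> [_ Foo]; rewrite fineK// ge0_fin_numE// sqnorm_ge0. Qed.

Lemma measurable_rnorm2 F : borel_fun F ->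
  measurable_fun setT (fun z => rnorm (F z) ^+ 2).
Proof.
move=> bF; apply: measurable_funX; apply: borel_measurable.
exact: borel_comp bF (@continuous_rnorm _ _).
Qed.

Lemma sqnormD_le F G : borel_fun F -> borel_fun G ->
  (sqnorm (fun z => F z + G z)%R <= 2%:E * sqnorm F + 2%:E * sqnorm G)%E.
Proof.
move=> bF bG; rewrite /sqnorm.
have m2 K : borel_fun K -> measurable_fun setT (fun z => (rnorm (K z) ^+ 2)%:E).
  by move=> bK; apply/measurable_EFinP; exact: measurable_rnorm2.
have p K z : (0 <= (rnorm (K z : H) ^+ 2)%:E)%E by rewrite lee_fin sqr_ge0.
rewrite -!ge0_integralZl//; try exact: m2.
rewrite -ge0_integralD//; last 4 first.
- by move=> z _; rewrite mule_ge0.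
- by apply: emeasurable_funM => //; exact: m2.
- by move=> z _; rewrite mule_ge0.
- by apply: emeasurable_funM => //; exact: m2.
apply: ge0_le_integral => //.
- by move=> z _; rewrite lee_fin sqr_ge0.
- by apply: m2; exact: borelD.
- by apply: emeasurable_funD; apply: emeasurable_funM => //; exact: m2.
- by move=> z _; rewrite -!EFinM -EFinD lee_fin !mulr_natl rnorm2D_le.
Qed.

Lemma L2D F G : L2 F -> L2 G -> L2 (fun z => F z + G z).
Proof.
move=> LF LG; split; first exact: borelD LF.1 LG.1.
apply: le_lt_trans (sqnormD_le LF.1 LG.1) _.
by rewrite !nsqE// -!EFinM -EFinD ltry.
Qed.

Lemma L2_cst (g : H) : L2 ((fun=> g) : C -> H).
Proof.
split; first by apply: borel_continuous; exact: cst_continuous.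
by rewrite /sqnorm integral_cst// -[X in (_ * X)%E]/(gaussian setT) (gaussianT R n) mule1 ltry.
Qed.

Lemma sqnormZ_unit (a : R[i]) F : rnorm a = 1 -> sqnorm (fun z => a *: F z) = sqnorm F.
Proof.
by move=> a1; apply: eq_integral => z _; rewrite rnormZ a1 mul1r.
Qed.

Lemma L2Z_unit (a : R[i]) F : rnorm a = 1 -> L2 F -> L2 (fun z => a *: F z).
Proof.
move=> a1 [bF Foo]; split; last by rewrite sqnormZ_unit.
by apply: (borelZ sH (k := fun=> a)) => //; exact: cst_continuous.
Qed.

Lemma rnormN1 : rnorm (-1 : R[i]) = 1.
Proof. by rewrite /rnorm normrN1. Qed.

Lemma L2N F : L2 F -> L2 (fun z => - F z).
Proof.
move=> LF; under eq_fun do rewrite -scaleN1r.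
exact: L2Z_unit rnormN1 LF.
Qed.

Lemma L2B F G : L2 F -> L2 G -> L2 (fun z => F z - G z).
Proof. by move=> LF LG; apply: L2D => //; exact: L2N. Qed.

Lemma nsqD_le F G : L2 F -> L2 G -> nsq (fun z => F z + G z) <= 2 * nsq F + 2 * nsq G.
Proof.
move=> LF LG; have := sqnormD_le LF.1 LG.1.
by rewrite !nsqE//; last exact: L2D.
Qed.

Lemma integrable_rnorm2 F : L2 F -> muG.-integrable setT (fun z => (rnorm (F z) ^+ 2)%:E).
Proof.
move=> [bF Foo]; apply/integrableP; split.
  by apply/measurable_EFinP; exact: measurable_rnorm2.
by under eq_integral do rewrite gee0_abs ?lee_fin ?sqr_ge0//.
Qed.

Definition rdot F G : R := \int[muG]_z redot (F z) (G z).

Lemma integrable_redot F G : L2 F -> L2 G ->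
  muG.-integrable setT (EFin \o (fun z => redot (F z) (G z))).
Proof.
move=> LF LG.
apply: (le_integrable _ _ _ (g := fun z => ((rnorm (F z) ^+ 2)%:E + (rnorm (G z) ^+ 2)%:E)%E)) => //=.
- apply/measurable_EFinP; rewrite (_ : (fun z => _) = fun z =>
    (rnorm (F z + G z) ^+ 2 - rnorm (F z) ^+ 2 - rnorm (G z) ^+ 2) / 2).
    apply: measurable_funM => //; apply: measurable_funB.
      apply: measurable_funB; apply: measurable_rnorm2; last exact: LF.1.
      exact: borelD LF.1 LG.1.
    apply: measurable_rnorm2; exact: LG.1.
  by apply/funext => z; rewrite redotE.
- move=> z _; rewrite lee_fin [leRHS]ger0_norm ?addr_ge0 ?sqr_ge0//.
  apply: le_trans (redot_le _ _) _; rewrite ler_pdivrMr// ler_peMr ?ler1n//.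
  by rewrite addr_ge0 ?sqr_ge0.
- by apply: integrableD => //; exact: integrable_rnorm2.
Qed.

Lemma rdotDl F G K : L2 F -> L2 G -> L2 K ->
  rdot (fun z => F z + G z) K = rdot F K + rdot G K.
Proof.
move=> LF LG LK; rewrite /rdot -RintegralD//; try exact: integrable_redot.
by apply: eq_Rintegral => z _; rewrite redotDl.
Qed.

Lemma rdotBl F G K : L2 F -> L2 G -> L2 K ->
  rdot (fun z => F z - G z) K = rdot F K - rdot G K.
Proof.
move=> LF LG LK; rewrite /rdot -RintegralB//; try exact: integrable_redot.
by apply: eq_Rintegral => z _; rewrite redotDl redotNl.
Qed.

Lemma rdotxx F : rdot F F = nsq F.
Proof. by congr fine; apply: eq_integral => z _; rewrite redotxx. Qed.

(** Polarization: an additive isometry for [nsq] preserves [rdot]. *)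
Lemma rdotE F G : L2 F -> L2 G ->
  rdot F G = (nsq (fun z => F z + G z) - nsq F - nsq G) / 2.
Proof.
move=> LF LG; have LFG := L2D LF LG.
rewrite -(rdotxx (fun z => F z + G z)) rdotDl//.
have rC A B : rdot A B = rdot B A.
  by apply: eq_Rintegral => z _; rewrite redotC.
rewrite (rC F (fun z => F z + G z)) (rC G (fun z => F z + G z)) (rdotDl LF LG LF) (rdotDl LF LG LG).
by rewrite !rdotxx (rC G F); move: (nsq F) (nsq G) (rdot F G) => a b c; field.
Qed.

Lemma rnormi : rnorm ('i : R[i]) = 1.
Proof. by rewrite /rnorm normc_def /= expr0n expr1n add0r sqrtr1. Qed.

Lemma l2dotE F G : l2dot F G = Complex (rdot F G) (rdot F (fun z => 'i *: G z)).
Proof.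
by congr Complex; apply: eq_Rintegral => z _; rewrite Im_hdot.
Qed.

End L2.

(** * The complex exponential *)

Section complex_exponential.
Variable R : realType.

Definition cexp (w : R[i]) : R[i] :=
  Complex (expR (complex.Re w) * cos (complex.Im w))
          (expR (complex.Re w) * sin (complex.Im w)).

Lemma cexpD a b : cexp (a + b) = cexp a * cexp b.
Proof.
case: a b => [a1 a2] [b1 b2]; rewrite /cexp /=.
by apply/eqP; rewrite eq_complex /= expRD cosD sinD; apply/andP; split; apply/eqP; ring.
Qed.

Lemma cexp0 : cexp 0 = 1.
Proof. by rewrite /cexp /= expR0 cos0 sin0 !mul1r. Qed.

Lemma rnorm_cexp a : rnorm (cexp a) = expR (complex.Re a).
Proof.
rewrite /rnorm normc_def /cexp /= !exprMn -mulrDr cos2Dsin2 mulr1.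
by rewrite sqrtr_sqr ger0_norm// expR_ge0.
Qed.

(** The derivative as an explicit first order estimate, to be combined for [expR],
    [cos] and [sin]. *)
Lemma is_derive_first_order (f : R -> R) (d : R) : is_derive (0 : R) 1 f d ->
  forall e, 0 < e -> exists2 r, 0 < r &
    forall h, `|h| < r -> `|f h - f 0 - d * h| <= e * `|h|.
Proof.
move=> [/[swap] dE]; rewrite /derivable => df e e0.
have {df} : h^-1 *: ((f \o shift 0) (h *: 1) - f 0) @[h --> 0^'] --> d.
  by rewrite -dE.
move=> /cvgrPdist_lt/(_ _ e0)[r /= r0 rP]; exists r => // h hr.
have [->|h0] := eqVneq h 0; first by rewrite subrr mulr0 subr0 normr0 mulr0.
have := rP h; rewrite /= sub0r normrN => /(_ hr h0) /ltW.
rewrite /= addr0 [h *: 1]mulr1 => H.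
rewrite -ler_pdivrMr ?normr_gt0// -normf_div -normrN; apply: le_trans H.
rewrite le_eqVlt; apply/orP; left; apply/eqP; congr `|_|.
by rewrite /GRing.scale /=; field.
Qed.

(** With [h = x + iy], each of the real and imaginary parts of [cexp h - 1 - h] is
    a combination of the three first order errors of [expR] at [x] and of [cos],
    [sin] at [y], plus [x y] in the imaginary part. *)
Lemma cexp_first_order (e : R) : 0 < e -> exists2 r : R, 0 < r &
  forall h : R[i], rnorm h < r -> rnorm (cexp h - 1 - h) <= e * rnorm h.
Proof.
(* [3 d |h|] for the real part and [4 d |h|] for the imaginary part *)
move=> e0; pose d := e / 7; have d0 : 0 < d by rewrite divr_gt0.
have [r1 r10 E1] := is_derive_first_order (@is_derive_expR R 0) d0.
have [r2 r20 E2] := is_derive_first_order (@is_derive_cos R 0) d0.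
have [r3 r30 E3] := is_derive_first_order (@is_derive_sin R 0) d0.
exists (Num.min (Num.min 1 d) (Num.min r1 (Num.min r2 r3))).
  by rewrite !lt_min ltr01 d0 r10 r20 r30.
move=> h; rewrite !lt_min => /andP[/andP[h1 hd] /and3P[hr1 hr2 hr3]].
have hx := Re_le_norm h; have hy := Im_le_norm h.
move: (rnorm h) (rnorm_ge0 h) h1 hd hr1 hr2 hr3 hx hy => N N0 h1 hd hr1 hr2 hr3 hx hy.
have {E1} := E1 _ (le_lt_trans hx hr1).
have {E2} := E2 _ (le_lt_trans hy hr2).
have {E3} := E3 _ (le_lt_trans hy hr3).
rewrite expR0 cos0 sin0 oppr0 mul0r !mul1r subr0 addr0.
set x := complex.Re h in hx *; set y := complex.Im h in hy *.
move=> S B A; apply: le_trans (norm_le_ReIm _) _.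
have x1 : `|x| <= 1 by apply: le_trans hx (ltW h1).
have xd : `|x| <= d by apply: le_trans hx (ltW hd).
have x2 : `|1 + x| <= 2.
  by apply: le_trans (ler_normD _ _) _; rewrite normr1; lra.
have dN : 0 <= d * N by rewrite mulr_ge0// ltW.
have dx : d * `|x| <= d * N by rewrite ler_pM2l.
have dy : d * `|y| <= d * N by rewrite ler_pM2l.
have pos := @normr_ge0 _ R.
have Re_le : `|complex.Re (cexp h - 1 - h)| <= 3 * (d * N).
  have -> : complex.Re (cexp h - 1 - h) =
      (expR x - 1 - x) * cos y + (1 + x) * (cos y - 1).
    by rewrite /cexp !raddfB /= -/x -/y; ring.
  apply: le_trans (ler_normD _ _) _; rewrite !normrM.
  have : `|expR x - 1 - x| * `|cos y| <= d * N.
    by rewrite -[leRHS]mulr1 ler_pM ?cos_max// (le_trans A).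
  have : `|1 + x| * `|cos y - 1| <= 2 * (d * N).
    by rewrite ler_pM// (le_trans B).
  move: (`|1 + x| * _) (`|expR x - 1 - x| * _) (d * N) => ? ? ? ? ?; lra.
have Im_le : `|complex.Im (cexp h - 1 - h)| <= 4 * (d * N).
  have -> : complex.Im (cexp h - 1 - h) =
      (expR x - 1 - x) * sin y + (1 + x) * (sin y - y) + x * y.
    by rewrite /cexp !raddfB /= -/x -/y; ring.
  apply: le_trans (ler_normD _ _) _; rewrite normrM.
  have : `|expR x - 1 - x| * `|sin y| <= d * N.
    by rewrite -[leRHS]mulr1 ler_pM ?sin_max// (le_trans A).
  have : `|1 + x| * `|sin y - y| <= 2 * (d * N).
    by rewrite ler_pM// (le_trans S).
  have : `|x| * `|y| <= d * N by rewrite ler_pM.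
  have := ler_normD ((expR x - 1 - x) * sin y) ((1 + x) * (sin y - y)); rewrite !normrM.
  move: (`|x| * `|y|) (`|1 + x| * _) (`|expR x - 1 - x| * _) (d * N) `|_ + _| => ? ? ? ? ? ? ? ?; lra.
have -> : e * N = 7 * (d * N) by rewrite /d; field.
move: Re_le Im_le; move: `|complex.Re _| `|complex.Im _| (d * N) => ? ? ? ? ?; lra.
Qed.

(** The functional equation reduces the derivative at [w] to the one at [0]. *)
Lemma differentiable_cexp (w : R[i]) : differentiable (cexp : R[i] -> R[i]) w.
Proof.
apply/derivable1_diffP; rewrite /derivable; apply/cvg_ex; exists (cexp w).
apply/cvgrPdist_lt => e e0.
have e'0 : 0 < complex.Re e by move: e0; rewrite ltcE => /andP[].
have W0 : 0 < rnorm (cexp w) by rewrite rnorm_cexp expR_gt0.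
have d0 : 0 < complex.Re e / rnorm (cexp w) / 2 by rewrite !divr_gt0.
have [r r0 rP] := cexp_first_order d0.
exists (real_complex R r) => /=; first by rewrite ltcR.
move=> h /=; rewrite sub0r normrN normE ltcR => hr h0.
rewrite lt_rnormP//.
have -> : cexp w - h^-1 *: (cexp (h *: 1 + w) - cexp w) =
    - (cexp w * ((cexp h - 1 - h) / h)).
  rewrite [h *: 1]mulr1 cexpD /GRing.scale /=; field.
  exact: h0.
rewrite rnormN rnormM rnormM.
have hN : 0 < rnorm h by rewrite -ltcR -normE normr_gt0.
have -> : rnorm h^-1 = (rnorm h)^-1.
  by apply: (mulfI (lt0r_neq0 hN)); rewrite -rnormM (divff h0) divff ?lt0r_neq0// /rnorm normr1.
rewrite -ltr_pdivlMl// ltr_pdivrMr//.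
apply: le_lt_trans (rP h hr) _; rewrite ltr_pM2r//.
rewrite [ltRHS]mulrC ltr_pdivrMr// ltr_pMr ?divr_gt0//; lra.
Qed.

End complex_exponential.

(** * The normalized reproducing kernel *)

Section weyl.
Local Open Scope complex_scope.
Variables (R : realType) (n : nat).
Local Notation C := (cspace R n).
Implicit Types u v z : C.

Definition cdot u z : R[i] := \sum_(j < n) u 0 j * conjc (z 0 j).

Definition kernel z u : R[i] := cexp (cdot u z - (cnorm z ^+ 2 / 2)%:C).

Lemma Re_cdot u z : complex.Re (cdot u z) = rdotc u z.
Proof.
rewrite /cdot raddf_sum; apply: eq_bigr => j _.
by case: (u 0 j) (z 0 j) => a b [c d] /=; rewrite mulrN opprK.
Qed.

Lemma cdotBl u v z : cdot (u - v) z = cdot u z - cdot v z.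
Proof. by rewrite /cdot -sumrB; apply: eq_bigr => j _; rewrite !mxE mulrBl. Qed.

Lemma cdotNl u z : cdot (- u) z = - cdot u z.
Proof. by rewrite /cdot -sumrN; apply: eq_bigr => j _; rewrite !mxE mulNr. Qed.

Lemma cdotNr u z : cdot u (- z) = - cdot u z.
Proof. by rewrite /cdot -sumrN; apply: eq_bigr => j _; rewrite !mxE raddfN mulrN. Qed.

Lemma cdotxx z : cdot z z = (cnorm z ^+ 2)%:C.
Proof.
rewrite cnorm2E rmorph_sum; apply: eq_bigr => j _.
by case: (z 0 j) => a b; apply/eqP; rewrite eq_complex /=; apply/andP; split; apply/eqP; ring.
Qed.

Lemma cnormN z : cnorm (- z) = cnorm z.
Proof. by rewrite /cnorm; congr Num.sqrt; apply: eq_bigr => j _; rewrite mxE rnormN. Qed.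

Lemma rnorm_kernel z u : rnorm (kernel z u) = kabs z u.
Proof. by rewrite rnorm_cexp raddfB /= Re_cdot. Qed.

(** The cocycle identity behind [W_{-z} W_z = 1]. *)
Lemma kernelNK z u : kernel (- z) u * kernel z (u - - z) = 1.
Proof.
rewrite /kernel -cexpD -[RHS](@cexp0 R) cnormN; congr cexp.
rewrite cdotBl cdotNr cdotNl cdotxx.
have -> : (cnorm z ^+ 2)%:C = (cnorm z ^+ 2 / 2)%:C + (cnorm z ^+ 2 / 2)%:C.
  by rewrite -rmorphD -splitr.
ring.
Qed.

Lemma differentiable_kernel z u : differentiable (kernel z : C -> R[i]) u.
Proof.
apply: (differentiable_comp (g := @cexp R)); last exact: differentiable_cexp.
apply: differentiableB; last exact: differentiable_cst.
rewrite (_ : cdot ^~ z = \sum_(j < n) (fun u : C => u 0 j * conjc (z 0 j))); last first.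
  by apply/funext => v; rewrite fct_sumE.
apply: differentiable_sum => j; apply: differentiableM.
  exact: differentiable_coord.
exact: differentiable_cst.
Qed.

Lemma continuous_kernel z : continuous (kernel z : C -> R[i]^o).
Proof. by move=> u; apply: differentiable_continuous; exact: differentiable_kernel. Qed.

Section scale_bilinear.
Variable V : normedModType R[i].

Let scale (a : R[i]) (v : V) := a *: v.

Let scale_is_bilinear : bilinear_for
    (GRing.Scale.Law.clone _ _ *:%R _) (GRing.Scale.Law.clone _ _ *:%R _) scale.
Proof.
split=> [v|a] b x y /=; rewrite /scale.
- by rewrite scalerDl scalerA.
- by rewrite scalerDr !scalerA mulrC.
Qed.

HB.instance Definition _ :=
  bilinear_isBilinear.Build R[i] R[i]^o V V _ _ scale scale_is_bilinear.

Lemma differentiable_scale (U : normedModType R[i]) (k : U -> R[i]) (f : U -> V) (x : U) :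
  differentiable k x -> differentiable f x ->
  differentiable (fun y => k y *: f y) x.
Proof.
move=> dk df.
apply: (differentiable_comp (f := fun y => (k y, f y)) (g := fun p : R[i]^o * V => scale p.1 p.2)).
  exact: differentiable_pair.
apply: differentiable_bilin => p; exact: scale_continuous.
Qed.

End scale_bilinear.
End weyl.

(** * Weyl operators and projections *)

Section weyl_operator.
Local Open Scope complex_scope.
Variables (R : realType) (n : nat) (H : hilbertType R).
Hypothesis sH : separable H.
Local Notation C := (cspace R n).
Local Notation muG := (@gaussian R n : {measure set C -> \bar R}).
Implicit Types (u v z : C) (F G K : C -> H).

Definition weyl z F : C -> H := fun u => kernel z u *: F (u - z).

Lemma weylNK z F : weyl (- z) (weyl z F) = F.
Proof.
by apply/funext => u; rewrite /weyl scalerA kernelNK scale1r opprK addrK.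
Qed.

Lemma weylKN z F : weyl z (weyl (- z) F) = F.
Proof. by rewrite -{1}[z]opprK weylNK. Qed.

Lemma weylD z F G : weyl z (fun u => F u + G u) = (fun u => weyl z F u + weyl z G u).
Proof. by apply/funext => u; rewrite /weyl scalerDr. Qed.

Lemma weylB z F G : weyl z (fun u => F u - G u) = (fun u => weyl z F u - weyl z G u).
Proof. by apply/funext => u; rewrite /weyl scalerBr. Qed.

Lemma borel_weyl z F : borel_fun F -> borel_fun (weyl z F).
Proof.
move=> bF; apply: (borelZ sH (@continuous_kernel R n z)).
exact: borel_translation (- z) bF.
Qed.

Lemma sqnorm_weyl z F : borel_fun F -> sqnorm (weyl z F) = sqnorm F.
Proof.
move=> bF; rewrite /sqnorm -[RHS](gaussian_translation z).
- by apply: eq_integral => u _; rewrite rnormZ exprMn rnorm_kernel mulrC EFinM.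
- by apply/measurable_EFinP; exact: measurable_rnorm2.
- by move=> u; rewrite lee_fin sqr_ge0.
Qed.

Lemma L2_weyl z F : L2 F -> L2 (weyl z F).
Proof. by move=> [bF Foo]; split; [exact: borel_weyl|rewrite sqnorm_weyl]. Qed.

Lemma rdot_weyl z F G : L2 F -> L2 G -> rdot (weyl z F) (weyl z G) = rdot F G.
Proof.
move=> LF LG; rewrite !(rdotE sH)//; try exact: L2_weyl.
rewrite -weylD /nsq !sqnorm_weyl//; [exact: LG.1|exact: LF.1|].
exact: (L2D sH LF LG).1.
Qed.

Lemma bargmann_weyl z F : bargmann F -> bargmann (weyl z F).
Proof.
move=> [dF LF]; split; last exact: L2_weyl.
move=> u; apply: differentiable_scale; first exact: differentiable_kernel.
apply: (differentiable_comp (f := fun u : C => u - z)); last exact: dF.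
by apply: differentiableB => //; exact: differentiable_cst.
Qed.

Lemma bargmannD F G : bargmann F -> bargmann G -> bargmann (fun u => F u + G u).
Proof.
move=> [dF LF] [dG LG]; split; last exact: L2D.
by move=> u; exact: differentiableD.
Qed.

Lemma bargmannZ_unit (a : R[i]) F : rnorm a = 1 -> bargmann F -> bargmann (fun u => a *: F u).
Proof.
move=> a1 [dF LF]; split; last exact: L2Z_unit.
by move=> u; exact: differentiableZ.
Qed.

Lemma bargmannB F G : bargmann F -> bargmann G -> bargmann (fun u => F u - G u).
Proof.
move=> bF bG; under eq_fun do rewrite -[- G _]scaleN1r.
apply: bargmannD => //; apply: bargmannZ_unit => //; exact: rnormN1.
Qed.

Lemma bargmann_cst (g : H) : bargmann ((fun=> g) : C -> H).
Proof. by split; [move=> z; exact: differentiable_cst|exact: L2_cst]. Qed.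

Lemma bargmann_kernel z (g : H) : bargmann (fun u => kernel z u *: g).
Proof. exact/(bargmann_weyl z)/bargmann_cst. Qed.

Lemma bargmann_sum (I : Type) (s : seq I) (F : I -> C -> H) :
  (forall i, bargmann (F i)) -> bargmann (fun u => \sum_(i <- s) F i u).
Proof.
move=> bF; elim: s => [|i s IH].
  by under eq_fun do rewrite big_nil; exact: bargmann_cst.
by under eq_fun do rewrite big_cons; exact: bargmannD.
Qed.

(** [is_proj F K] is the defining property of [bargmann_proj F]; as a relation
    it can be transported and added whenever witnesses are at hand. *)
Definition is_proj F K := bargmann K /\
  forall G, bargmann G -> l2dot (fun z => F z - K z) G = 0.

(** The Bargmann space is stable under multiplication by ['i], so orthogonality
    can be tested on real parts. *)
Lemma is_projP F K : bargmann K ->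
  is_proj F K <-> (forall G, bargmann G -> rdot (fun z => F z - K z) G = 0).
Proof.
move=> bK; split=> [[_ +] G bG|FK].
  by move=> /(_ _ bG); rewrite l2dotE => -[].
split=> // G bG; rewrite l2dotE !FK//.
exact: bargmannZ_unit (rnormi R) bG.
Qed.

Lemma is_proj_bargmann_proj F K : is_proj F K -> is_proj F (bargmann_proj F).
Proof. by move=> FK; rewrite /bargmann_proj; apply: xgetPex; exists K. Qed.

(** [K - K'] is both in the Bargmann space and orthogonal to it. *)
Lemma is_proj_uniq F K K' : L2 F -> is_proj F K -> is_proj F K' ->
  nsq (fun z => K z - K' z) = 0.
Proof.
move=> LF pK pK'; have [bK bK'] := (pK.1, pK'.1).
have bD := bargmannB bK bK'.
have LFK : L2 (fun z => F z - K z) by apply: L2B => //; exact: bK.2.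
have LFK' : L2 (fun z => F z - K' z) by apply: L2B => //; exact: bK'.2.
rewrite -rdotxx.
have -> : rdot (fun z => K z - K' z) (fun z => K z - K' z) =
  rdot (fun z => (F z - K' z) - (F z - K z)) (fun z => K z - K' z).
  by apply: eq_Rintegral => z _; rewrite opprB [X in _ = redot X _]addrC addrA subrK.
rewrite rdotBl//; last exact: bD.2.
by rewrite ((is_projP _ bK).1 pK)// ((is_projP _ bK').1 pK')// subr0.
Qed.

Lemma is_proj0 : is_proj (fun=> 0) (fun=> 0).
Proof.
apply/(is_projP _ (bargmann_cst 0)) => G bG.
rewrite /rdot /Rintegral integral0_eq// => z _.
by rewrite subrr /redot hdot0l.
Qed.

Lemma is_projD F K F' K' : L2 F -> L2 F' -> is_proj F K -> is_proj F' K' ->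
  is_proj (fun z => F z + F' z) (fun z => K z + K' z).
Proof.
move=> LF LF' pK pK'; have [bK bK'] := (pK.1, pK'.1).
apply/(is_projP _ (bargmannD bK bK')) => G bG.
have -> : rdot (fun z => F z + F' z - (K z + K' z)) G =
    rdot (fun z => (F z - K z) + (F' z - K' z)) G.
  by apply: eq_Rintegral => z _; rewrite opprD addrACA.
rewrite rdotDl//; try exact: L2B; last exact: bG.2.
- by rewrite ((is_projP _ bK).1 pK)// ((is_projP _ bK').1 pK')// addr0.
- by apply: L2B => //; exact: bK.2.
- by apply: L2B => //; exact: bK'.2.
Qed.

Lemma L2_sum (I : Type) (s : seq I) (F : I -> C -> H) :
  (forall i, L2 (F i)) -> L2 (fun u => \sum_(i <- s) F i u).
Proof.
move=> LF; elim: s => [|i s IH].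
  by under eq_fun do rewrite big_nil; exact: L2_cst.
by under eq_fun do rewrite big_cons; exact: L2D.
Qed.

Lemma is_proj_sum (I : Type) (s : seq I) (F K : I -> C -> H) :
  (forall i, L2 (F i)) -> (forall i, is_proj (F i) (K i)) ->
  is_proj (fun z => \sum_(i <- s) F i z) (fun z => \sum_(i <- s) K i z).
Proof.
move=> LF pK; elim: s => [|i s IH].
  under eq_fun do rewrite big_nil; under [X in is_proj _ X]eq_fun do rewrite big_nil.
  exact: is_proj0.
under eq_fun do rewrite big_cons; under [X in is_proj _ X]eq_fun do rewrite big_cons.
by apply: is_projD => //; exact: L2_sum.
Qed.

(** [W_z] is a unitary preserving the Bargmann space: move it to the other side
    as [W_{-z}]. *)
Lemma is_proj_weyl z F K : L2 F -> is_proj F K -> is_proj (weyl z F) (weyl z K).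
Proof.
move=> LF pK; have bK := pK.1.
apply/(is_projP _ (bargmann_weyl z bK)) => G bG.
rewrite -weylB -[G](weylKN z) rdot_weyl.
- by apply: (is_projP _ bK).1 => //; exact: bargmann_weyl.
- by apply: L2B => //; exact: bK.2.
- by apply: L2_weyl; exact: bG.2.
Qed.

Lemma nsq_is_proj_le F K K' : L2 F -> is_proj F K -> is_proj F K' ->
  nsq K <= 2 * nsq K'.
Proof.
move=> LF pK pK'; have [bK bK'] := (pK.1, pK'.1).
have := nsqD_le sH (bargmannB bK bK').2 bK'.2.
rewrite (is_proj_uniq LF pK pK') mulr0 add0r.
by under eq_fun do rewrite subrK.
Qed.

End weyl_operator.

(** * Almost orthogonality of the kernels *)

Section almost_orthogonal.
Local Open Scope complex_scope.
Variables (R : realType) (n : nat).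
Local Notation C := (cspace R n).
Local Notation muG := (@gaussian R n : {measure set C -> \bar R}).
Implicit Types u v w z : C.

(** The product of two kernels is, up to a constant, the square of the kernel at
    the midpoint (parallelogram identity). *)
Lemma kabsM z w u : let m : C := \row_j Complex
    ((complex.Re (z 0 j) + complex.Re (w 0 j)) / 2)
    ((complex.Im (z 0 j) + complex.Im (w 0 j)) / 2) in
  kabs z u * kabs w u = expR (- (cnorm (z - w) ^+ 2 / 4)) * kabs m u ^+ 2.
Proof.
move=> m; rewrite /kabs -expRM_natl -!expRD; congr expR.
have E1 : rdotc u m = (rdotc u z + rdotc u w) / 2.
  rewrite /rdotc -big_split/= mulr_suml; apply: eq_bigr => j _.
  by rewrite mxE /=; field.
have E2 : cnorm m ^+ 2 = (cnorm z ^+ 2 + cnorm w ^+ 2) / 2 - cnorm (z - w) ^+ 2 / 4.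
  rewrite !cnorm2E -big_split/= !mulr_suml -sumrB; apply: eq_bigr => j _.
  by rewrite !mxE !raddfB /=; field.
by rewrite E1 E2; move: (cnorm _ ^+ 2) (cnorm z ^+ 2) (cnorm w ^+ 2) => a b c; field.
Qed.

Lemma integral_kabs2 z : (\int[muG]_u (kabs z u ^+ 2)%:E = 1)%E.
Proof.
have := @gaussian_translation R n z (cst 1%E) (measurable_cst _) (fun=> lee01).
under eq_integral do rewrite mul1e.
by rewrite integral_cst// mul1e => ->; exact: gaussianT.
Qed.

Lemma measurable_kabs2 z : measurable_fun setT (fun u => (kabs z u ^+ 2)%:E).
Proof. by apply/measurable_EFinP; apply: measurable_funX; exact: measurable_kabs. Qed.

Lemma integral_kabsM z w :
  (\int[muG]_u (kabs z u * kabs w u)%:E =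
   (expR (- (cnorm (z - w)%R ^+ 2 / 4)))%:E)%E.
Proof.
under eq_integral do rewrite kabsM EFinM.
rewrite ge0_integralZl//; last 2 first.
- exact: measurable_kabs2.
- by move=> u _; rewrite lee_fin sqr_ge0.
by rewrite integral_kabs2 mule1.
Qed.

(** Coordinatewise, [2 a b <= 2 a^2 + b^2 / 2]. *)
Lemma cnormB2_ge z w : cnorm w ^+ 2 / 2 - cnorm z ^+ 2 <= cnorm (z - w) ^+ 2.
Proof.
rewrite !cnorm2E mulr_suml -sumrB; apply: ler_sum => j _.
rewrite !mxE !raddfB /=.
move: (complex.Re (z 0 j)) (complex.Im (z 0 j)) (complex.Re (w 0 j)) (complex.Im (w 0 j)) => a b c d.
have := sqr_ge0 (a *+ 2 - c); have := sqr_ge0 (b *+ 2 - d); nra.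
Qed.

Variable q : nat -> C.
Hypothesis qP : forall i j, (i < j)%N ->
  expR (- (cnorm (q i - q j) ^+ 2 / 4)) <= j.+1%:R^-1.

(** In the induction, the new diagonal term contributes [1] and the [2 N] new cross
    terms at most [1 / (N + 1)] each. *)
Lemma integral_kabs_sum2_le N :
  (\int[muG]_u ((\sum_(i < N) kabs (q i) u) ^+ 2)%:E <= (3 * N%:R)%:E)%E.
Proof.
elim: N => [|N IH].
  by rewrite integral0_eq ?mulr0// => u _; rewrite big_ord0 expr0n.
pose A u := \sum_(i < N) kabs (q i) u.
have mA : measurable_fun setT A by apply: measurable_sum => i; exact: measurable_kabs.
have mk i : measurable_fun setT (kabs (q i)) by exact: measurable_kabs.
under eq_integral => u _.
  rewrite big_ord_recr/= sqrrD -/(A u) mulr_suml.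
  rewrite EFinD EFinD.
  over.
have mm i : measurable_fun setT (fun u => (kabs (q i) u * kabs (q N) u)%:E).
  by apply/measurable_EFinP; exact: measurable_funM.
have ms : measurable_fun setT (fun u => ((\sum_(i < N) kabs (q i) u * kabs (q N) u) *+ 2)%:E).
  apply/measurable_EFinP; under eq_fun do rewrite -mulr_natr.
  by apply: measurable_funM => //; apply: measurable_sum => i; exact: measurable_funM.
have k0 i u : 0 <= kabs (q i) u * kabs (q N) u by rewrite mulr_ge0 ?kabs_ge0.
have s0 u : (0 <= ((\sum_(i < N) kabs (q i) u * kabs (q N) u) *+ 2)%:E)%E.
  by rewrite lee_fin mulrn_wge0// sumr_ge0.
have mA2 : measurable_fun setT (fun u => (A u ^+ 2)%:E).
  by apply/measurable_EFinP; exact: measurable_funX.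
rewrite ge0_integralD//; last 4 first.
- by move=> u _; rewrite adde_ge0// lee_fin sqr_ge0.
- exact: emeasurable_funD.
- by move=> u _; rewrite lee_fin sqr_ge0.
- exact: measurable_kabs2.
rewrite ge0_integralD//; last by move=> u _; rewrite lee_fin sqr_ge0.
rewrite integral_kabs2.
have -> : (\int[muG]_u ((\sum_(i < N) kabs (q i) u * kabs (q N) u) *+ 2)%:E =
   2%:E * \sum_(i < N) (expR (- (cnorm (q i - q N)%R ^+ 2 / 4)))%:E)%E.
  under eq_integral => u _ do rewrite -mulr_natl EFinM -sumEFin.
  rewrite ge0_integralZl//; last 2 first.
  - by apply: emeasurable_sum => i.
  - by move=> u _; apply: sume_ge0 => i _; rewrite lee_fin.
  rewrite ge0_integral_sum//; last by move=> i u _; rewrite lee_fin.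
  by under eq_bigr do rewrite integral_kabsM.
rewrite sumEFin -EFinM.
apply: (@le_trans _ _ ((3 * N%:R)%:E + (2 * 1)%:E + 1)%E).
  rewrite leeD// leeD// lee_fin ler_pM2l//.
  apply: (@le_trans _ _ (\sum_(i < N) N.+1%:R^-1)).
    by apply: ler_sum => i _; exact: qP.
  rewrite sumr_const card_ord -[_ *+ N]mulr_natl ler_pdivrMr// mul1r ler_nat; exact: leqnSn.
by rewrite -!EFinD lee_fin -natr1; lra.
Qed.

Variable H : hilbertType R.
Hypothesis sH : separable H.

Lemma nsq_kernel_sum_le (g : H) N :
  nsq (fun u : C => \sum_(i < N) kernel (q i) u *: g) <= 3 * N%:R * rnorm g ^+ 2.
Proof.
have LF : L2 (fun u : C => \sum_(i < N) kernel (q i) u *: g).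
  by apply: L2_sum => // i; exact: (bargmann_kernel sH (q i) g).2.
rewrite -lee_fin -(nsqE LF).
have mA : measurable_fun setT (fun u => ((\sum_(i < N) kabs (q i) u) ^+ 2)%:E).
  by apply/measurable_EFinP; apply: measurable_funX; apply: measurable_sum => i; exact: measurable_kabs.
apply: (@le_trans _ _ (\int[muG]_u ((\sum_(i < N) kabs (q i) u) ^+ 2 * rnorm g ^+ 2)%:E)%E).
  apply: ge0_le_integral => //.
  - by move=> u _; rewrite lee_fin sqr_ge0.
  - by apply/measurable_EFinP; exact: (measurable_rnorm2 LF.1).
  - by under eq_fun do rewrite EFinM; exact: emeasurable_funM.
  - move=> u _; rewrite lee_fin -scaler_suml rnormZ exprMn ler_wpM2r ?sqr_ge0//.
    rewrite ler_sqr ?nnegrE ?rnorm_ge0 ?sumr_ge0// => [|i _]; last exact: kabs_ge0.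
    elim/big_ind2 : _ => [|x1 x2 y1 y2 h1 h2|i _]; rewrite ?rnorm0 ?rnorm_kernel//.
    by apply: le_trans (ler_rnormD _ _) _; exact: lerD.
under eq_integral do rewrite EFinM.
have A0 u : setT u -> (0 <= ((\sum_(i < N) kabs (q i) u) ^+ 2)%:E)%E.
  by rewrite lee_fin sqr_ge0.
have g0 : (0 <= (rnorm g ^+ 2)%:E)%E by rewrite lee_fin sqr_ge0.
rewrite (ge0_integralZr _ measurableT mA A0 g0) [leRHS]EFinM.
by apply: lee_wpmul2r => //; exact: integral_kabs_sum2_le.
Qed.

End almost_orthogonal.

Section averages.
Local Open Scope complex_scope.
Variables (R : realType) (n : nat) (H : hilbertType R).
Hypothesis sH : separable H.
Local Notation C := (cspace R n).
Local Notation muG := (@gaussian R n : {measure set C -> \bar R}).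

Lemma nsq_sum_le N (F : 'I_N -> C -> H) : (forall i, L2 (F i)) ->
  nsq (fun u => \sum_(i < N) F i u) <= N%:R * \sum_(i < N) nsq (F i).
Proof.
move=> LF; have LS := L2_sum sH (index_enum 'I_N) LF.
rewrite -lee_fin -(nsqE LS) EFinM -sumEFin.
under eq_bigr do rewrite -(nsqE (LF _)).
have m2 i : measurable_fun setT (fun u => (rnorm (F i u) ^+ 2)%:E).
  by apply/measurable_EFinP; exact: (measurable_rnorm2 (LF i).1).
have p0 i u : (0 <= (rnorm (F i u) ^+ 2)%:E)%E by rewrite lee_fin sqr_ge0.
rewrite /sqnorm -ge0_integral_sum// -ge0_integralZl//; last 2 first.
- exact: emeasurable_sum.
- by move=> u _; apply: sume_ge0.
apply: ge0_le_integral => //.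
- by move=> u _; rewrite lee_fin sqr_ge0.
- by apply/measurable_EFinP; exact: (measurable_rnorm2 LS.1).
- by apply: emeasurable_funM => //; exact: emeasurable_sum.
- move=> u _; rewrite sumEFin -EFinM lee_fin.
  apply: le_trans (rnorm2_sum_le _ _) _.
  by rewrite [size _](_ : _ = N)// -[RHS](size_enum_ord N) enumT.
Qed.

Lemma nsqMn (G : C -> H) N : L2 G -> nsq (fun u => G u *+ N) = N%:R ^+ 2 * nsq G.
Proof.
move=> LG.
have E u : (rnorm (G u *+ N) ^+ 2)%:E = ((N%:R ^+ 2)%:E * (rnorm (G u) ^+ 2)%:E)%E.
  rewrite -scaler_nat rnormZ exprMn EFinM; congr ((_ ^+ 2)%:E * _)%E.
  by rewrite /rnorm normr_nat -(rmorph_nat (real_complex R)).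
rewrite -[RHS]/(fine (N%:R ^+ 2 * nsq G)%:E) EFinM -(nsqE LG); congr fine.
rewrite /sqnorm -ge0_integralZl//.
- by apply: eq_integral => u _; rewrite E.
- by apply/measurable_EFinP; exact: (measurable_rnorm2 LG.1).
- by move=> u _; rewrite lee_fin sqr_ge0.
Qed.

(** [N G = sum_i K_i - sum_i (K_i - G)]: the first sum has squared norm [O(N)], the
    second at most [N^2 d]; divide by [N^2] and choose [N] large. *)
Lemma nsq_limit_le (K : nat -> C -> H) (G : C -> H) (d B : R) : 0 < d ->
  (forall i, L2 (K i)) -> L2 G ->
  (forall i, nsq (fun u => K i u - G u) <= d) ->
  (forall N, nsq (fun u => \sum_(i < N) K i u) <= B * N%:R) ->
  nsq G <= 3 * d.
Proof.
move=> d0 LK LG KG KB.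
(* then [N^2 g <= 2 B N + 2 N^2 d <= 3 N^2 d] *)
have [N N0 NB] : exists2 N : nat, (0 < N)%N & 2 * B <= d * N%:R.
  have h := archi_boundP (normr_ge0 (2 * B / d)).
  exists (Num.bound `|2 * B / d|); first by rewrite -(ltr0n R) (le_lt_trans _ h).
  by rewrite -ler_pdivrMl// mulrC; apply: le_trans (ler_norm _) (ltW h).
have LD i : L2 (fun u => K i u - G u) by exact: L2B.
have LS := L2_sum sH (index_enum 'I_N) (fun i : 'I_N => LK i).
have LSD := L2_sum sH (index_enum 'I_N) (fun i : 'I_N => LD i).
have := nsqD_le sH LS (L2N sH LSD).
have -> : nsq (fun u => (\sum_(i < N) K i u) - (\sum_(i < N) (K i u - G u))) =
    N%:R ^+ 2 * nsq G.
  rewrite -nsqMn//; congr nsq; apply/funext => u.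
  by rewrite sumrB opprB addrC subrK sumr_const card_ord.
have -> : nsq (fun u => - (\sum_(i < N) (K i u - G u))) =
   nsq (fun u => \sum_(i < N) (K i u - G u)).
  by congr fine; apply: eq_integral => u _; rewrite rnormN.
have := nsq_sum_le (fun i : 'I_N => LD i).
have : N%:R * \sum_(i < N) nsq (fun u => K i u - G u) <= N%:R ^+ 2 * d.
  rewrite expr2 -mulrA ler_wpM2l//.
  apply: le_trans (ler_sum _ (fun (i : 'I_N) _ => KG i)) _.
  by rewrite sumr_const card_ord mulr_natl.
have := KB N; have : 0 < N%:R :> R by rewrite ltr0n.
move: (nsq _) (nsq _) (\sum_(_ < _) _) (nsq G) (N%:R : R) NB => S D s g M NB M0 SB sd Ds gSD.
have : M ^+ 2 * g <= M ^+ 2 * (3 * d) by nra.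
by rewrite ler_pM2l// exprn_gt0.
Qed.

End averages.

(** * Toeplitz operators on coherent states *)

Section toeplitz.
Local Open Scope complex_scope.
Variables (R : realType) (n : nat) (H : hilbertType R).
Hypothesis sH : separable H.
Local Notation C := (cspace R n).
Variable Phi : C -> bop H.
Implicit Types (z : C) (g : H).

Lemma l2normE (F : C -> H) : l2norm F = Num.sqrt (nsq F).
Proof. by []. Qed.

Lemma l2norm2 (F : C -> H) : l2norm F ^+ 2 = nsq F.
Proof. by rewrite l2normE sqr_sqrtr// nsq_ge0. Qed.

Definition coherent z g : C -> H := fun u => kernel z u *: g.

Lemma bargmann_coherent z g : bargmann (coherent z g).
Proof. exact: bargmann_kernel. Qed.

Lemma nsq_coherent z g : nsq (coherent z g) = rnorm g ^+ 2.
Proof.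
rewrite /nsq (_ : coherent z g = weyl z (fun=> g))// sqnorm_weyl//.
  by rewrite /sqnorm integral_cst// [X in (_ * X)%E]gaussianT mule1.
exact: (L2_cst n g).1.
Qed.

Lemma weyl_symbol z g :
  weyl z (fun u => Phi (u + z) g) = op_mul Phi (coherent z g).
Proof.
by apply/funext => u; rewrite /weyl /op_mul /coherent linearZ /= subrK.
Qed.

Hypothesis T_bounded : toeplitz_bounded Phi.

Lemma L2_op_mul (F : C -> H) : bargmann F -> L2 (op_mul Phi F).
Proof. by have [<- _] := T_bounded => -[]. Qed.

(** Either [Phi_z (x) g] has no projection and [P = 0] by default, or [W_z P] is a
    projection of [Phi (k_z (x) g)], hence comparable with [T_Phi (k_z (x) g)]. *)
Lemma sqnorm_shifted_le z g (P := bargmann_proj (fun u => Phi (u + z) g)) :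
  sqnorm P = 0%E \/
  is_proj (op_mul Phi (coherent z g)) (toeplitz Phi (coherent z g)) /\
  (sqnorm P <= (2 * nsq (toeplitz Phi (coherent z g)))%:E)%E.
Proof.
have [[K PK]|noK] := pselect (exists K, is_proj (fun u => Phi (u + z) g) K); [right|left].
  have LT := L2_op_mul (bargmann_coherent z g).
  have LPhi : L2 (fun u : C => Phi (u + z) g).
    by rewrite -[X in L2 X](weylNK z) weyl_symbol; exact: L2_weyl.
  have pP : is_proj (fun u => Phi (u + z) g) P by exact: is_proj_bargmann_proj PK.
  have pW : is_proj (op_mul Phi (coherent z g)) (weyl z P).
    by rewrite -weyl_symbol; exact: is_proj_weyl.
  have pT : is_proj (op_mul Phi (coherent z g)) (toeplitz Phi (coherent z g)).
    exact: is_proj_bargmann_proj pW.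
  split=> //; rewrite -(sqnorm_weyl z pP.1.2.1) (nsqE pW.1.2) lee_fin.
  exact: nsq_is_proj_le LT pW pT.
have -> : P = fun=> 0.
  by apply: xgetPN => K PK; apply: noK; exists K.
by rewrite /sqnorm integral0_eq// => u _; rewrite rnorm0 expr0n.
Qed.

(** The sum of the given projections is a projection of the sum, hence almost
    everywhere equal to the value of [toeplitz Phi] there. *)
Lemma nsq_toeplitz_sum_le (B : R) :
  (forall F : C -> H, bargmann F -> l2norm (toeplitz Phi F) <= B * l2norm F) ->
  forall N (F : 'I_N -> C -> H),
  (forall i, bargmann (F i)) ->
  (forall i, is_proj (op_mul Phi (F i)) (toeplitz Phi (F i))) ->
  nsq (fun u => \sum_(i < N) toeplitz Phi (F i) u) <=
  2 * (B ^+ 2 * nsq (fun u => \sum_(i < N) F i u)).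
Proof.
move=> BP N F bF pF; set S := (fun u => \sum_(i < N) F i u).
have bS : bargmann S by exact: bargmann_sum.
have pS : is_proj (op_mul Phi S) (fun u => \sum_(i < N) toeplitz Phi (F i) u).
  have -> : op_mul Phi S = fun u => \sum_(i < N) op_mul Phi (F i) u.
    by apply/funext => u; rewrite /op_mul /S linear_sum.
  by apply: is_proj_sum => // i; exact: L2_op_mul.
have pT := is_proj_bargmann_proj pS.
apply: le_trans (nsq_is_proj_le sH (L2_op_mul bS) pS pT) _.
rewrite ler_pM2l// -!l2norm2 -exprMn ler_sqr ?nnegrE ?sqrtr_ge0//.
  exact: BP.
by apply: le_trans (BP _ bS); exact: sqrtr_ge0.
Qed.

(** Given points [p M] of norm larger than [M], a sequence growing so fast that
    [|z_{j+1}|^2 >= 2 |z_j|^2 + 8 (j + 1)]; by [cnormB2_ge] this gives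
    [|z_i - z_j|^2 / 4 >= j] for [i < j]. *)
Fixpoint sparse (p : R -> C) k : C :=
  match k with
  | 0 => p 0
  | j.+1 => p (2 * cnorm (sparse p j) ^+ 2 + 8 * j.+1%:R)
  end.

Lemma sparse_separated p : (forall M, M < cnorm (p M)) ->
  forall i j, (i < j)%N ->
  expR (- (cnorm (sparse p i - sparse p j) ^+ 2 / 4)) <= j.+1%:R^-1.
Proof.
move=> pP.
have step j : 2 * cnorm (sparse p j) ^+ 2 + 8 * j.+1%:R <= cnorm (sparse p j.+1) ^+ 2.
  rewrite [sparse p j.+1]/=; set M := _ + _.
  have M1 : 1 <= M.
    have := sqr_ge0 (cnorm (sparse p j)); rewrite /M -[j.+1%:R]natr1.
    have : 0 <= j%:R :> R by []. 
    move: (j%:R) (_ ^+ 2) => a b ? ?; lra.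
  apply: (@le_trans _ _ (M ^+ 2)); first by rewrite expr2 ler_peMl// (le_trans ler01).
  have M0 : 0 <= M by exact: le_trans M1.
  by rewrite ler_sqr ?nnegrE ?sqrtr_ge0//; exact: ltW.
have mono i k : cnorm (sparse p i) ^+ 2 <= cnorm (sparse p (i + k)) ^+ 2.
  elim: k => [|k IH]; first by rewrite addn0.
  rewrite addnS; apply: le_trans (step _); apply: le_trans IH _.
  have := sqr_ge0 (cnorm (sparse p (i + k))).
  have : 0 <= (i + k).+1%:R :> R by [].
  move: (_%:R) (_ ^+ 2) => a b ? ?; lra.
move=> i [//|j]; rewrite ltnS => ij.
rewrite expRN lef_pV2 ?posrE ?expR_gt0 ?ltr0n//.
apply: le_trans (expR_ge1Dx _).
have := cnormB2_ge (sparse p i) (sparse p j.+1).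
have := mono i (j - i)%N; rewrite subnKC//; have := step j; rewrite -[j.+2%:R]natr1.
move: (_ ^+ 2) (_ ^+ 2) (cnorm (_ - _) ^+ 2) (cnorm (sparse p i) ^+ 2) (j.+1%:R).
by move=> a b c d e ? ? ?; lra.
Qed.

End toeplitz.

(** * Compact Toeplitz operators *)

Section compact.
Variables (R : realType) (n : nat) (H : hilbertType R).
Hypothesis sH : separable H.
Local Notation C := (cspace R n).
Variable Phi : C -> bop H.
Hypothesis T_bounded : toeplitz_bounded Phi.
Hypothesis T_compact : toeplitz_compact Phi.

(** By contradiction along a sparse sequence: compactness gives a limit [G], which
    must be small by [nsq_limit_le] although it is close to vectors of squared
    norm at least [e]. *)
Lemma toeplitz_coherent_small (g : H) (e : R) : 0 < e ->
  exists M : R, forall z : C, M < cnorm z ->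
  is_proj (op_mul Phi (coherent z g)) (toeplitz Phi (coherent z g)) ->
  nsq (toeplitz Phi (coherent z g)) < e.
Proof.
move=> e0; apply: contrapT => noM.
have /choice[p pP] : forall M, exists z : C, [/\ M < cnorm z,
    is_proj (op_mul Phi (coherent z g)) (toeplitz Phi (coherent z g)) &
    e <= nsq (toeplitz Phi (coherent z g))].
  move=> M; apply: contrapT => noz; apply: noM; exists M => z Mz pz.
  by rewrite ltNge; apply/negP => ez; apply: noz; exists z.
pose zz := sparse p.
have zzP k : is_proj (op_mul Phi (coherent (zz k) g)) (toeplitz Phi (coherent (zz k) g)) /\
    e <= nsq (toeplitz Phi (coherent (zz k) g)).
  have [M ->] : exists M, zz k = p M by case: k => [|k]; eexists; reflexivity.
  by have [] := pP M.
have sep := sparse_separated (fun M => let: And3 h _ _ := pP M in h).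
have bf k : bargmann (coherent (zz k) g) by exact: bargmann_coherent.
have [|s [s_mono [G bG sG]]] := T_compact bf.
  by exists (Num.sqrt (rnorm g ^+ 2)) => k; rewrite l2normE nsq_coherent.
have sge k : (k <= s k)%N.
  by elim: k => // k IH; apply: leq_ltn_trans IH (s_mono _ _ (ltnSn k)).
have [_ [B BP]] := T_bounded.
(* [d <= 1] turns [l2norm < d] into [nsq <= d]; [e <= 2 d + 2 (3 d) <= 4 e / 5]. *)
pose d := Num.min 1 (e / 10).
have d0 : 0 < d by rewrite lt_min ltr01 divr_gt0.
have [m _ mP] := (cvgr0Pnorm_lt _).1 sG d d0.
pose q i := zz (s (m + i)%N).
pose K i := toeplitz Phi (coherent (q i) g).
have bK i : bargmann (K i) := (zzP (s (m + i)%N)).1.1.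
have KG i : nsq (fun u => K i u - G u) <= d.
  have := mP (m + i)%N (leq_addr _ _).
  rewrite /= ger0_norm ?sqrtr_ge0// => /ltW h.
  rewrite -l2norm2; apply: (@le_trans _ _ (d * d)).
    by rewrite expr2 ler_pM ?sqrtr_ge0.
  by rewrite ler_piMl ?(ltW d0)// ge_min lexx.
have qP i j : (i < j)%N -> expR (- (cnorm (q i - q j) ^+ 2 / 4)) <= j.+1%:R^-1.
  move=> ij; apply: le_trans (sep _ _ _) _.
    by apply: s_mono; rewrite ltn_add2l.
  rewrite lef_pV2 ?posrE ?ltr0n// ler_nat ltnS.
  by apply: leq_trans (sge _); exact: leq_addl.
have KB N : nsq (fun u => \sum_(i < N) K i u) <=
    (6 * B ^+ 2 * rnorm g ^+ 2) * N%:R.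
  apply: le_trans (nsq_toeplitz_sum_le sH T_bounded BP (F := fun i : 'I_N => coherent (q i) g) _ _) _.
  - by move=> i; exact: bargmann_coherent.
  - by move=> i; exact: (zzP _).1.
  have := nsq_kernel_sum_le qP sH g N; rewrite -/(coherent _ _).
  move=> h; have {h} := ler_wpM2l (sqr_ge0 B) h.
  rewrite /coherent; move: (_ * nsq _) => x; lra.
have Gd := nsq_limit_le sH d0 (fun i => (bK i).2) bG.2 KG KB.
have := nsqD_le sH (bargmannB sH (bK 0%N) bG).2 bG.2.
under eq_fun do rewrite subrK.
have := KG 0%N; have := (zzP (s (m + 0)%N)).2; rewrite -/(K 0%N).
have : d <= e / 10 by rewrite ge_min lexx orbT.
move: d d0 Gd {KG mP} => d d0 Gd de eK KG KK.
have : e <= e * (4 / 5) by rewrite (le_trans eK)// (le_trans KK)//; lra.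
lra.
Qed.

End compact.

Unset Implicit Arguments.

Theorem proposition3p7 (R : realType) (n : nat) (H : hilbertType R)
    (Hsep : separable H) (Phi : cspace R n -> bop H)
    (Phi_borel : borel_fun Phi) (T_bounded : toeplitz_bounded Phi)
    (T_compact : toeplitz_compact Phi) (g : H) :
  (\int[@gaussian R n]_w
     (rnorm (bargmann_proj (fun u => Phi (u + z) g) w) ^+ 2)%:E)%E
    @[z --> @cnorm_pinfty R n] --> 0%E.
Proof.
move=> U [e /= e0 eU].
have e20 : 0 < e / 2 by rewrite divr_gt0.
have [M MP] := toeplitz_coherent_small Hsep T_bounded T_compact g e20.
exists M => // z /MP small; rewrite /preimage /=.
set P := bargmann_proj _; change (U (sqnorm P)).
have [->|[pT PT]] := sqnorm_shifted_le Hsep T_bounded z g.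
  by apply: eU; rewrite /ball_ /= subrr normr0.
have Pe : (sqnorm P < e%:E)%E.
  apply: le_lt_trans PT _; rewrite lte_fin mulrC -ltr_pdivlMr//; exact: small.
have P0 := sqnorm_ge0 P.
rewrite -(@fineK _ (sqnorm P)); last by rewrite ge0_fin_numE// (lt_trans Pe)// ltry.
apply: eU; rewrite /ball_ /= sub0r normrN ger0_norm ?fine_ge0//.
by rewrite -lte_fin fineK// ge0_fin_numE// (lt_trans Pe)// ltry.
Qed.
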